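(* Let $K$ be a field, $\mathcal X$ a multihomogeneous variety of representations of Lie algebras over $K$, and $\Theta$ a variety of Lie algebras over $K$. Let $L$ be an absolutely free Lie algebra over $K$ with free generators $\{x_i,i\in I\}$, $\mathcal F$ the absolutely free associative algebra with unity freely generated by $\{x_i,i\in I\}$, $L_1$ an absolutely free Lie algebra over $K$ with free generators $\{y_i,i\in I\}$, and $\Phi$ the absolutely free associative algebra with unity freely generated by $\{y_i,i\in I\}$. Let $\bar x_i$ be the image of $x_i$ in $L/\Theta(L)$. Then the free cyclic pair $(\mathcal F/(\mathcal X\times\Theta)^*(\mathcal F,L),\,L)$ of the variety $\mathcal X\times\Theta$ is isomorphic to the subrepresentation of the mixed wreath $\mathcal X$-product $(\Phi/\mathcal X^*(\Phi,L_1),L_1)\stackrel{\mathcal X}{\mathrm{wr}}L/\Theta(L)$ generated by the elements $y_i+\bar x_i$, $i\in I$.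
   Context: **Pairs.** A representation of a Lie algebra over $K$ (a Lie pair) is a pair $(V,A)$, where $A$ is a Lie algebra over $K$ and $V$ is a right $A$-module, equivalently a right $U(A)$-module ($U(A)$ is the universal enveloping algebra). A homomorphism $(V,A)\to(V',A')$ is a pair consisting of a linear map $V\to V'$ and a Lie algebra homomorphism $A\to A'$ compatible with the actions. A subpair (subrepresentation) consists of a Lie subalgebra and a subspace invariant under it. **Varieties.** An (action) identity is an expression $y\,v(x_1,\dots,x_n)=0$, with $v$ in the free associative algebra with unity on $x_1,x_2,\dots$; it holds in $(V,A)$ if $w\,v(a_1,\dots,a_n)=0$ for all $w\in V$, $a_j\in A$. A variety of representations is the class of all pairs over $K$ satisfying some set of such identities. It is multihomogeneous if, whenever $yv=0$ is an identity of the variety and $v=\sum_\alpha v_\alpha$ is the decomposition of $v$ into multihomogeneous components, each $yv_\alpha=0$ is also an identity of the variety. **Verbal submodule, free cyclic pairs.** For a variety $\mathcal Y$ of representations and a pair $(V,A)$, $\mathcal Y^*(V,A)$ is the $A$-submodule of $V$ generated by all $w\,v(a_1,\dots,a_n)$ with $w\in V$, $a_j\in A$ and $yv=0$ an identity of $\mathcal Y$; it is the least submodule $V_0$ with $(V/V_0,A)\in\mathcal Y$. With $L$ acting on $\mathcal F=U(L)$ by right multiplication, $(\mathcal F/\mathcal Y^*(\mathcal F,L),L)$ is the free cyclic pair of $\mathcal Y$ freely generated by $\{x_i\}$; similarly $(\Phi/\mathcal X^*(\Phi,L_1),L_1)$ for $\mathcal X$ and $\{y_i\}$. **Product with a variety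 of Lie algebras.** For a Lie algebra $A$, $\Theta(A)$ denotes the verbal ideal of $A$ corresponding to $\Theta$ (the least ideal with $A/\Theta(A)\in\Theta$). $\mathcal X\times\Theta$ is the variety of all pairs $(V,A)$ such that $(V,\Theta(A))\in\mathcal X$, equivalently such that $A$ has an ideal $H$ with $(V,H)\in\mathcal X$ and $A/H\in\Theta$. **Mixed wreath $\mathcal X$-product.** Let $(V,A)\in\mathcal X$ and let $B$ be a Lie algebra over $K$. A pair $(G,\Gamma)$, with $B$ a subalgebra of $\Gamma$, is the mixed wreath $\mathcal X$-product of $(V,A)$ and $B$, denoted $(V,A)\stackrel{\mathcal X}{\mathrm{wr}}B$, if: 1. $(V,A)$ is a subpair of $(G,\Gamma)$; 2. $A$ and $B$ generate $\Gamma$; 3. $V$ generates $G$ as a $\Gamma$-module; 4. if $P$ is the ideal of $\Gamma$ generated by $A$, then $(G,P)\in\mathcal X$; 5. whenever $\varphi:(V,A)\to(G_1,\Gamma_1)$ and $\psi:B\to\Gamma_1$ are homomorphisms such that $\varphi(A)$ and $\psi(B)$ generate $\Gamma_1$, $\varphi(V)$ generates $G_1$ as a $\Gamma_1$-module, and $(G_1,Q)\in\mathcal X$ where $Q$ is the ideal of $\Gamma_1$ generated by $\varphi(A)$, there is a unique homomorphism $\chi:(G,\Gamma)\to(G_1,\Gamma_1)$ restricting to $\varphi$ on $(V,A)$ and to $\psi$ on $B$. When $\mathcal X$ is multihomogeneous, $K$ is a field and $(V,A)=(\Phi/\mathcal X^*(\Phi,L_1),L_1)$, it can be realized with $\Gamma=L_1*B=P\rtimes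 B$ (free product of Lie algebras, $P$ the ideal generated by $L_1$) and $G=U(\Gamma)/\mathcal X^*(U(\Gamma),P)\cong U(B)\otimes_K\big(U(P)/\mathcal X^*(U(P),P)\big)$, with $\Gamma$ acting by right multiplication on $U(\Gamma)$. **Convention.** The subrepresentation generated by the elements $y_i+\bar x_i$ is the cyclic subpair $(W,N)$, where $N$ is the Lie subalgebra of $\Gamma$ generated by all $y_i+\bar x_i$ and $W$ is the $N$-submodule of $G$ generated by the distinguished generator, i.e. the image of $1\in\Phi$ in $\Phi/\mathcal X^*(\Phi,L_1)\subset G$. *)

(* Defs.v *)
From HB Require Import structures.
From mathcomp Require Import all_boot all_order all_algebra.
From mathcomp Require Import finmap.
From mathcomp Require Import boolp classical_sets.
From mathcomp Require Import monalg.

Set Implicit Arguments.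
Unset Strict Implicit.
Unset Printing Implicit Defensive.

Import GRing.Theory.
Local Open Scope ring_scope.
Local Open Scope quotient_scope.

Fact malg_scalerAr (M : monomType) (K : fieldType) (c : K) (f g : {malg K[M]}) :
  c *: (f * g) = f * (c *: g).
Proof.
apply/malgP => k; rewrite mcoeffZ (mcoeffMlw k (fsubset_refl _) (msuppZ_le c g)).
rewrite mcoeffMl mulr_sumr; apply: eq_bigr => k1 _; rewrite mulr_sumr.
by apply: eq_bigr => k2 _; rewrite mcoeffZ mulrnAr mulrCA.
Qed.

(** The free associative algebra with unity on [I], as the algebra of the free
    monoid of words [{fmonom I}]. The alias is needed because the library
    attaches [algType] to [{malg K[M]}] only for commutative monoids [M]. *)
Definition freeAssoc (K : fieldType) (I : choiceType) : Type :=
  {malg K[{fmonom I}]}.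

Section FreeAssoc.
Variables (K : fieldType) (I : choiceType).

HB.instance Definition _ := GRing.Lalgebra.on (freeAssoc K I).
HB.instance Definition _ :=
  GRing.Lalgebra_isAlgebra.Build K (freeAssoc K I)
    (@malg_scalerAr {fmonom I} K).

Definition assocGen (i : I) : freeAssoc K I := << fmu i >>.

End FreeAssoc.

HB.mixin Record Lmodule_isLie (K : fieldType) A of GRing.Lmodule K A := {
  lie : A -> A -> A;
  lie_linearl : forall b, linear (fun a => lie a b);
  lie_linearr : forall a, linear (lie a);
  liexx : forall a, lie a a = 0;
  lie_jacobi : forall a b c,
    lie a (lie b c) + lie b (lie c a) + lie c (lie a b) = 0 }.

#[short(type="lieAlgType")]
HB.structure Definition LieAlgebra (K : fieldType) :=
  { A of GRing.Lmodule K A & Lmodule_isLie K A }.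

Record lieHom (K : fieldType) (A B : lieAlgType K) := LieHom {
  lhom :> {linear A -> B};
  lhom_lie : forall a b, lhom (lie a b) = lie (lhom a) (lhom b) }.

Definition commLie (K : fieldType) (R : algType K) : Type := R.

Section CommLie.
Variables (K : fieldType) (R : algType K).

HB.instance Definition _ := GRing.Lmodule.on (commLie R).

Definition comm_br (a b : commLie R) : commLie R := (a : R) * b - (b : R) * a.

Fact comm_br_linearl b : linear (fun a => comm_br a b).
Proof.
move=> c a a'; rewrite /comm_br mulrDl mulrDr -scalerAl -scalerAr.
by rewrite scalerBr opprD addrACA.
Qed.

Fact comm_br_linearr a : linear (comm_br a).
Proof.
move=> c b b'; rewrite /comm_br mulrDl mulrDr -scalerAl -scalerAr.
by rewrite scalerBr opprD addrACA.
Qed.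

Fact comm_brxx a : comm_br a a = 0. Proof. exact: subrr. Qed.

Fact comm_br_jacobi a b c :
  comm_br a (comm_br b c) + comm_br b (comm_br c a) + comm_br c (comm_br a b)
  = 0.
Proof.
rewrite /comm_br !mulrBr !mulrBl !mulrA !opprB !addrA.
rewrite [LHS](ACl ((1*12)*(2*7)*(3*10)*(4*5)*(6*11)*(8*9)))%AC /=.
by rewrite !subrr !addNr !addr0.
Qed.

HB.instance Definition _ := Lmodule_isLie.Build K (commLie R)
  comm_br_linearl comm_br_linearr comm_brxx comm_br_jacobi.

End CommLie.

Record subspace (K : fieldType) (V : lmodType K) := Subspace {
  ssp :> {pred V};
  sspP : submod_closed ssp }.

Section Subspace.
Variables (K : fieldType) (V : lmodType K) (S : subspace V).

HB.instance Definition _ := GRing.isSubmodClosed.Build K V (ssp S)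
  (GRing.submod_closed_semi (sspP S)).

Definition subv : Type := {v : V | v \in ssp S}.

HB.instance Definition _ := [isSub of subv for @sval V (fun v => v \in ssp S)].
HB.instance Definition _ := [Choice of subv by <:].
HB.instance Definition _ := [SubChoice_isSubLmodule of subv by <:].

Definition quotv : Type := Quotient.quot (ssp S).
HB.instance Definition _ := Choice.on quotv.
HB.instance Definition _ := EqQuotient.on quotv.
HB.instance Definition _ := GRing.Zmodule.on quotv.

Definition quotv_scale (c : K) : quotv -> quotv := lift_op1 quotv ( *:%R c).

Fact pi_quotv_scale c : {morph \pi_quotv : u / c *: u >-> quotv_scale c u}.
Proof.
move=> u; unlock quotv_scale; apply/eqP.
rewrite piE Quotient.equivE -scalerBr rpredZ //.
by rewrite Quotient.idealrBE reprK.
Qed.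
Canonical pi_quotv_scale_morph c := PiMorph1 (pi_quotv_scale c).

Fact quotv_scaleA a b (v : quotv) :
  quotv_scale a (quotv_scale b v) = quotv_scale (a * b) v.
Proof. by rewrite -[v]reprK !piE scalerA. Qed.

Fact quotv_scale1 : left_id 1 quotv_scale.
Proof. by move=> v; rewrite -[v]reprK !piE scale1r. Qed.

Fact quotv_scaleDr : right_distributive quotv_scale +%R.
Proof. by move=> a u v; rewrite -[u]reprK -[v]reprK !piE scalerDr. Qed.

Fact quotv_scaleDl v : {morph quotv_scale^~ v : a b / a + b}.
Proof. by move=> a b; rewrite -[v]reprK !piE scalerDl. Qed.

HB.instance Definition _ := GRing.Zmodule_isLmodule.Build K quotv
  quotv_scaleA quotv_scale1 quotv_scaleDr quotv_scaleDl.

Definition projv (v : V) : quotv := \pi_quotv v.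

Fact projv_is_linear : linear projv.
Proof. by move=> c u v; rewrite /projv !piE. Qed.
HB.instance Definition _ := GRing.isLinear.Build K V quotv *:%R projv
  projv_is_linear.

Lemma projv_eq u v : (projv u == projv v) = (u - v \in ssp S).
Proof. by rewrite Quotient.idealrBE. Qed.

End Subspace.


Section LieSubobjects.
Variables (K : fieldType) (A : lieAlgType K).

Record lieSub := LieSub {
  lsub :> subspace A;
  lsub_lie : {in lsub &, forall a b, lie a b \in lsub} }.

Record lieIdeal := LieIdeal {
  lideal :> subspace A;
  lideal_lie : forall a b, a \in lideal -> lie a b \in lideal }.

Fact lieSub_of_ideal_subproof (J : lieIdeal) :
  {in lideal J &, forall a b, lie a b \in lideal J}.
Proof. by move=> a b Ja _; apply: lideal_lie. Qed.
Coercion lieSub_of_ideal (J : lieIdeal) : lieSub :=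
  LieSub (@lieSub_of_ideal_subproof J).

Fact lieC (a b : A) : lie a b = - lie b a.
Proof.
have lD x y z : lie (x + y) z = lie x z + lie y z.
  by have := lie_linearl z 1 x y; rewrite !scale1r.
have rD x y z : lie z (x + y) = lie z x + lie z y.
  by have := lie_linearr z 1 x y; rewrite !scale1r.
apply/eqP; rewrite -addr_eq0; have := liexx (a + b).
by rewrite lD !rD !liexx add0r addr0 => ->.
Qed.

End LieSubobjects.

Section SubLie.
Variables (K : fieldType) (A : lieAlgType K) (H : lieSub A).

Definition subLie : Type := subv H.
HB.instance Definition _ := SubType.on subLie.
HB.instance Definition _ := GRing.Lmodule.on subLie.

Definition subLie_lie (a b : subLie) : subLie :=
  exist _ (lie (sval a) (sval b)) (lsub_lie (svalP a) (svalP b)).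

Fact subLie_linearl b : linear (fun a => subLie_lie a b).
Proof. by move=> c u v; apply: val_inj; rewrite /= lie_linearl. Qed.
Fact subLie_linearr a : linear (subLie_lie a).
Proof. by move=> c u v; apply: val_inj; rewrite /= lie_linearr. Qed.
Fact subLie_xx a : subLie_lie a a = 0.
Proof. by apply: val_inj; rewrite /= liexx. Qed.
Fact subLie_jacobi a b c :
  subLie_lie a (subLie_lie b c) + subLie_lie b (subLie_lie c a)
    + subLie_lie c (subLie_lie a b) = 0.
Proof. by apply: val_inj; rewrite /= lie_jacobi. Qed.
HB.instance Definition _ := Lmodule_isLie.Build K subLie
  subLie_linearl subLie_linearr subLie_xx subLie_jacobi.

End SubLie.

Section QuotLie.
Variables (K : fieldType) (A : lieAlgType K) (J : lieIdeal A).

Definition quotLie : Type := quotv J.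
HB.instance Definition _ := EqQuotient.on quotLie.
HB.instance Definition _ := GRing.Lmodule.on quotLie.

Definition projLie : A -> quotLie := projv J.
HB.instance Definition _ := GRing.Linear.on projLie.

Definition quotLie_lie (a b : quotLie) : quotLie :=
  projLie (lie (repr a) (repr b)).

Fact projLie_repr a : projLie (repr a) = a.
Proof. exact: reprK. Qed.

Fact projLie_lie a b : projLie (lie a b) = quotLie_lie (projLie a) (projLie b).
Proof.
apply/eqP; rewrite projv_eq.
have d x : x - repr (projLie x) \in ssp J by rewrite -projv_eq; apply/eqP/esym/(projLie_repr (projLie x)).
set a' := repr _; set b' := repr _.
have -> : lie a b - lie a' b' = lie (a - a') b + lie a' (b - b').
  have lB x y z : lie (x - y) z = lie x z - lie y z.
    have := lie_linearl z (-1) y x; rewrite !scaleN1r => /= e.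
    by rewrite addrC e addrC.
  have rB x y z : lie z (x - y) = lie z x - lie z y.
    have := lie_linearr z (-1) y x; rewrite !scaleN1r => /= e.
    by rewrite addrC e addrC.
  by rewrite lB rB addrA subrK.
rewrite rpredD //; first exact: (lideal_lie (l := J)) (d a).
by rewrite lieC rpredN; apply: (lideal_lie (l := J)) (d b).
Qed.

Fact quotLie_linearl b : linear (fun a => quotLie_lie a b).
Proof.
move=> c u v; rewrite -[u]projLie_repr -[v]projLie_repr -[b]projLie_repr.
by rewrite -linearP -!projLie_lie lie_linearl linearP.
Qed.
Fact quotLie_linearr a : linear (quotLie_lie a).
Proof.
move=> c u v; rewrite -[u]projLie_repr -[v]projLie_repr -[a]projLie_repr.
by rewrite -linearP -!projLie_lie lie_linearr linearP.
Qed.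
Fact quotLie_xx a : quotLie_lie a a = 0.
Proof. by rewrite -[a]projLie_repr -projLie_lie liexx linear0. Qed.
Fact quotLie_jacobi a b c :
  quotLie_lie a (quotLie_lie b c) + quotLie_lie b (quotLie_lie c a)
    + quotLie_lie c (quotLie_lie a b) = 0.
Proof.
rewrite -[a]projLie_repr -[b]projLie_repr -[c]projLie_repr -!projLie_lie.
by rewrite -!linearD lie_jacobi linear0.
Qed.
HB.instance Definition _ := Lmodule_isLie.Build K quotLie
  quotLie_linearl quotLie_linearr quotLie_xx quotLie_jacobi.

End QuotLie.

Section LieGenerated.
Variables (K : fieldType) (A : lieAlgType K) (X : set A).

Definition lieGen_pred : {pred A} :=
  fun a => `[< forall H : lieSub A, (forall x, X x -> x \in H) -> a \in H >].

Fact lieGen_closed : submod_closed lieGen_pred.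
Proof.
split; first by apply/asboolP => H _; apply: (sspP H).1.
move=> c u v /asboolP Hu /asboolP Hv; apply/asboolP => H XH.
by apply: (sspP H).2; [apply: Hu | apply: Hv].
Qed.

Fact lieGen_lie :
  {in Subspace lieGen_closed &, forall a b, lie a b \in Subspace lieGen_closed}.
Proof.
move=> u v /asboolP Hu /asboolP Hv; apply/asboolP => H XH.
by apply: lsub_lie; [apply: Hu | apply: Hv].
Qed.

Definition lieGen : lieSub A := LieSub lieGen_lie.

Definition idealGen_pred : {pred A} :=
  fun a => `[< forall J : lieIdeal A, (forall x, X x -> x \in J) -> a \in J >].

Fact idealGen_closed : submod_closed idealGen_pred.
Proof.
split; first by apply/asboolP => J _; apply: (sspP J).1.
move=> c u v /asboolP Hu /asboolP Hv; apply/asboolP => J XJ.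
by apply: (sspP J).2; [apply: Hu | apply: Hv].
Qed.

Fact idealGen_lie (a b : A) : a \in Subspace idealGen_closed ->
  lie a b \in Subspace idealGen_closed.
Proof.
move=> /asboolP Ha; apply/asboolP => J XJ.
by apply: lideal_lie; apply: Ha.
Qed.

Definition idealGen : lieIdeal A := LieIdeal idealGen_lie.

End LieGenerated.

(** Right modules: hence the order of the factors in [pact_lie]. *)
Record liePair (K : fieldType) := LiePair {
  pmod : lmodType K;
  palg : lieAlgType K;
  pact : pmod -> palg -> pmod;
  pact_linearl : forall a, linear (fun w => pact w a);
  pact_linearr : forall w, linear (pact w);
  pact_lie : forall w a b,
    pact w (lie a b) = pact (pact w a) b - pact (pact w b) a }.

Record pairHom (K : fieldType) (P Q : liePair K) := PairHom {
  hmod : {linear pmod P -> pmod Q};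
  halg : lieHom (palg P) (palg Q);
  hact : forall w a, hmod (pact w a) = pact (hmod w) (halg a) }.

Definition pair_isom (K : fieldType) (P Q : liePair K) : Prop :=
  exists f : pairHom P Q, bijective (hmod f) /\ bijective (halg f).

Record submodule (K : fieldType) (P : liePair K) := Submodule {
  smod :> subspace (pmod P);
  smod_act : forall w a, w \in smod -> pact w a \in smod }.

Section PairConstructions.
Variables (K : fieldType) (P : liePair K).

Section Restriction.
Variable H : lieSub (palg P).

Definition restrPair_act (w : pmod P) (a : subLie H) := pact w (sval a).

Fact restrPair_linearl a : linear (fun w => restrPair_act w a).
Proof. by move=> c u v; rewrite /restrPair_act pact_linearl. Qed.
Fact restrPair_linearr w : linear (restrPair_act w).
Proof. by move=> c u v; rewrite /restrPair_act /= pact_linearr. Qed.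
Fact restrPair_lie w a b : restrPair_act w (lie a b) =
  restrPair_act (restrPair_act w a) b - restrPair_act (restrPair_act w b) a.
Proof. exact: pact_lie. Qed.

Definition restrPair : liePair K :=
  LiePair restrPair_linearl restrPair_linearr restrPair_lie.
End Restriction.

Section SubmoduleGenerated.
Variable X : set (pmod P).

Definition submodGen_pred : {pred pmod P} :=
  fun w => `[< forall S : submodule P, (forall x, X x -> x \in S) -> w \in S >].

Fact submodGen_closed : submod_closed submodGen_pred.
Proof.
split; first by apply/asboolP => S _; apply: (sspP S).1.
move=> c u v /asboolP Su /asboolP Sv; apply/asboolP => S XS.
by apply: (sspP S).2; [apply: Su | apply: Sv].
Qed.

Fact submodGen_act (w : pmod P) a : w \in Subspace submodGen_closed ->
  pact w a \in Subspace submodGen_closed.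
Proof.
move=> /asboolP Sw; apply/asboolP => S XS.
by apply: smod_act; apply: Sw.
Qed.

Definition submodGen : submodule P := Submodule submodGen_act.
End SubmoduleGenerated.

Section SubQuotient.
Variable W : submodule P.

Definition submodPair_act (w : subv W) (a : palg P) : subv W :=
  exist _ (pact (sval w) a) (smod_act a (svalP w)).

Fact submodPair_linearl a : linear (fun w => submodPair_act w a).
Proof. by move=> c u v; apply: val_inj; rewrite /= pact_linearl. Qed.
Fact submodPair_linearr w : linear (submodPair_act w).
Proof. by move=> c u v; apply: val_inj; rewrite /= pact_linearr. Qed.
Fact submodPair_lie w a b : submodPair_act w (lie a b) =
  submodPair_act (submodPair_act w a) b - submodPair_act (submodPair_act w b) a.
Proof. by apply: val_inj; rewrite /= pact_lie. Qed.

Definition submodPair : liePair K :=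
  LiePair submodPair_linearl submodPair_linearr submodPair_lie.

Definition quotPair_act (w : quotv W) (a : palg P) : quotv W :=
  projv W (pact (repr w) a).

Fact projv_repr (w : quotv W) : projv W (repr w) = w.
Proof. exact: reprK. Qed.

Fact projv_act w a : projv W (pact w a) = quotPair_act (projv W w) a.
Proof.
apply/eqP; rewrite projv_eq.
have d : w - repr (projv W w) \in ssp W.
  by rewrite -projv_eq; apply/eqP/esym/(projv_repr (projv W w)).
have := pact_linearl a (-1) (repr (projv W w)) w.
rewrite !scaleN1r => e; rewrite addrC -e; apply: smod_act.
by rewrite addrC.
Qed.

Fact quotPair_linearl a : linear (fun w => quotPair_act w a).
Proof.
move=> c u v; rewrite -[u]projv_repr -[v]projv_repr -linearP -!projv_act.
by rewrite pact_linearl linearP.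
Qed.
Fact quotPair_linearr w : linear (quotPair_act w).
Proof.
by move=> c a b; rewrite -[w]projv_repr -!projv_act pact_linearr linearP.
Qed.
Fact quotPair_lie w a b : quotPair_act w (lie a b) =
  quotPair_act (quotPair_act w a) b - quotPair_act (quotPair_act w b) a.
Proof. by rewrite -[w]projv_repr -!projv_act pact_lie linearB. Qed.

Definition quotPair : liePair K :=
  LiePair quotPair_linearl quotPair_linearr quotPair_lie.
End SubQuotient.

End PairConstructions.

(** The subpair generated by a set [N] of elements of the Lie algebra and a
    single vector [g]: the module part is generated by [g] over the subalgebra
    generated by [N]. *)
Definition cyclicSubpair (K : fieldType) (P : liePair K)
    (g : pmod P) (N : set (palg P)) : liePair K :=
  submodPair (submodGen (P := restrPair (lieGen N)) [set g]).

(** [(R, L)], where [L] acts on the associative algebra [R] by right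
    multiplication through [eta : L -> R]. *)
Section MulPair.
Variables (K : fieldType) (R : algType K) (L : lieAlgType K).
Variable eta : lieHom L (commLie R).

Definition mulPair_act (f : R) (a : L) : R := f * (eta a : R).

Fact mulPair_linearl a : linear (fun w => mulPair_act w a).
Proof. by move=> c u v; rewrite /mulPair_act mulrDl scalerAl. Qed.
Fact mulPair_linearr w : linear (mulPair_act w).
Proof.
by move=> c a b; rewrite /mulPair_act linearP mulrDr scalerAr.
Qed.
Fact mulPair_lie w a b : mulPair_act w (lie a b) =
  mulPair_act (mulPair_act w a) b - mulPair_act (mulPair_act w b) a.
Proof. by rewrite /mulPair_act lhom_lie mulrBr !mulrA. Qed.

Definition mulPair : liePair K :=
  LiePair mulPair_linearl mulPair_linearr mulPair_lie.
End MulPair.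

Definition repClass (K : fieldType) := liePair K -> Prop.

(** The value [w v(a_0, a_1, ...)] of the action polynomial [y v]. *)
Definition act_value (K : fieldType) (P : liePair K) (w : pmod P)
    (a : nat -> palg P) (v : freeAssoc K nat) : pmod P :=
  \sum_(m <- msupp v) v@_m *: foldl (@pact K P) w [seq a i | i <- fmonom_val m].

Definition pair_satisfies (K : fieldType) (P : liePair K)
    (v : freeAssoc K nat) : Prop :=
  forall w a, act_value (P := P) w a v = 0.

Definition is_rep_variety (K : fieldType) (X : repClass K) : Prop :=
  exists E : set (freeAssoc K nat),
    forall P, X P <-> (forall v, E v -> pair_satisfies P v).

Definition rep_identity (K : fieldType) (X : repClass K)
    (v : freeAssoc K nat) : Prop :=
  forall P, X P -> pair_satisfies P v.

(** The multihomogeneous component of [v] of degree [alpha i] in the variable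
    number [i], for every [i]. *)
Definition mh_component (K : fieldType) (alpha : nat -> nat)
    (v : freeAssoc K nat) : freeAssoc K nat :=
  \sum_(m <- msupp v | `[< forall i, count_mem i (fmonom_val m) = alpha i >])
    v@_m *: (<< m >> : freeAssoc K nat).

Definition multihomogeneous (K : fieldType) (X : repClass K) : Prop :=
  forall v, rep_identity X v ->
  forall alpha, rep_identity X (mh_component alpha v).

Definition verbal_submodule (K : fieldType) (X : repClass K) (P : liePair K) :
    submodule P :=
  submodGen [set u | exists w a v,
    rep_identity X v /\ u = act_value (P := P) w a v].

Definition free_cyclic_pair (K : fieldType) (X : repClass K) (I : choiceType)
    (L : lieAlgType K) (eta : lieHom L (commLie (freeAssoc K I))) : liePair K :=
  quotPair (verbal_submodule X (mulPair eta)).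

Definition free_cyclic_gen (K : fieldType) (X : repClass K) (I : choiceType)
    (L : lieAlgType K) (eta : lieHom L (commLie (freeAssoc K I))) :
    pmod (free_cyclic_pair X eta) :=
  projv (verbal_submodule X (mulPair eta)) (1 : freeAssoc K I).

Definition lieClass (K : fieldType) := lieAlgType K -> Prop.

(** Lie identities are given by formal expressions standing for elements of the
    free Lie algebra on countably many variables. *)
Inductive lie_term (K : fieldType) : Type :=
| LieVar of nat
| LieAdd of lie_term K & lie_term K
| LieScale of K & lie_term K
| LieBr of lie_term K & lie_term K.

Fixpoint lie_value (K : fieldType) (A : lieAlgType K) (a : nat -> A)
    (t : lie_term K) : A :=
  match t with
  | LieVar i => a i
  | LieAdd t1 t2 => lie_value a t1 + lie_value a t2
  | LieScale c t1 => c *: lie_value a t1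
  | LieBr t1 t2 => lie (lie_value a t1) (lie_value a t2)
  end.

Definition is_lie_variety (K : fieldType) (Theta : lieClass K) : Prop :=
  exists E : set (lie_term K),
    forall A, Theta A <-> (forall t, E t -> forall a : nat -> A, lie_value a t = 0).

(** The intersection of all ideals [J] with [A / J] in [Theta]; when [Theta] is
    a variety it is itself such an ideal, hence the least one. *)
Section VerbalIdeal.
Variables (K : fieldType) (Theta : lieClass K) (A : lieAlgType K).

Definition verbal_ideal_pred : {pred A} :=
  fun a => `[< forall J : lieIdeal A, Theta (quotLie J) -> a \in J >].

Fact verbal_ideal_closed : submod_closed verbal_ideal_pred.
Proof.
split; first by apply/asboolP => J _; apply: (sspP J).1.
move=> c u v /asboolP Ju /asboolP Jv; apply/asboolP => J TJ.
by apply: (sspP J).2; [apply: Ju | apply: Jv].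
Qed.

Fact verbal_ideal_lie (a b : A) : a \in Subspace verbal_ideal_closed ->
  lie a b \in Subspace verbal_ideal_closed.
Proof.
move=> /asboolP Ja; apply/asboolP => J TJ.
by apply: lideal_lie; apply: Ja.
Qed.

Definition verbal_ideal : lieIdeal A := LieIdeal verbal_ideal_lie.
End VerbalIdeal.

Definition rep_product (K : fieldType) (X : repClass K) (Theta : lieClass K) :
    repClass K :=
  fun P => X (restrPair (verbal_ideal Theta (palg P))).

Definition is_free_lie (K : fieldType) (I : Type) (L : lieAlgType K)
    (x : I -> L) : Prop :=
  forall (A : lieAlgType K) (f : I -> A),
    exists2 h : lieHom L A, forall i, h (x i) = f i &
      forall h' : lieHom L A, (forall i, h' (x i) = f i) -> h' =1 h.

(** The part of the definition of the mixed wreath product shared by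
    [(G, Gamma)] itself and by the pairs it is compared with: [phi (A)] and
    [psi (B)] generate the Lie algebra, [phi (V)] generates the module, and the
    ideal generated by [phi (A)] acts as prescribed by [X]. *)
Record wreath_cocone (K : fieldType) (X : repClass K) (P : liePair K)
    (B : lieAlgType K) (Q : liePair K) (phi : pairHom P Q)
    (psi : lieHom B (palg Q)) : Prop := {
  cocone_alg : forall g, g \in lieGen (range (halg phi) `|` range psi)%classic;
  cocone_mod : forall w, w \in submodGen (range (hmod phi));
  cocone_ideal : X (restrPair (idealGen (range (halg phi)))) }.

(** [Q] is the pair [(G, Gamma)]; the inclusions of [P = (V, A)] and of [B] in it
    are the injective homomorphisms [phi] and [psi]. *)
Record is_mixed_wreath (K : fieldType) (X : repClass K) (P : liePair K)
    (B : lieAlgType K) (Q : liePair K) (phi : pairHom P Q)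
    (psi : lieHom B (palg Q)) : Prop := {
  wreath_base : X P;
  wreath_inj_mod : injective (hmod phi);
  wreath_inj_alg : injective (halg phi);
  wreath_inj_top : injective psi;
  wreath_is_cocone : wreath_cocone X phi psi;
  wreath_univ : forall (Q1 : liePair K) (phi1 : pairHom P Q1)
      (psi1 : lieHom B (palg Q1)), wreath_cocone X phi1 psi1 ->
    exists2 chi : pairHom Q Q1,
      [/\ forall w, hmod chi (hmod phi w) = hmod phi1 w,
          forall a, halg chi (halg phi a) = halg phi1 a
        & forall b, halg chi (psi b) = psi1 b]
    & forall chi' : pairHom Q Q1,
      [/\ forall w, hmod chi' (hmod phi w) = hmod phi1 w,
          forall a, halg chi' (halg phi a) = halg phi1 a
        & forall b, halg chi' (psi b) = psi1 b] ->
      hmod chi' =1 hmod chi /\ halg chi' =1 halg chi }.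

(* Main.v *)
(** Write B = L/Theta(L). The map of the theorem is h : L -> Gamma,
    x_i |-> y_i + xbar_i, together with f |-> g f on cyclic modules. It is
    surjective by construction, and it is well defined because h - psi o p takes
    its values in the ideal P generated by L_1, so that h maps Theta(L) into P.

    Injectivity is tested by the universal property, i.e. by cocones. On Lie
    algebras, the cocone (0, L) with y_i |-> x_i and xbar_i |-> 0 retracts h. On
    modules, let M be the free cyclic pair of X x Theta. One needs a pair in which M
    embeds and x_i acts as y_i + xbar_i, where B acts and the y_i lie in an ideal
    acting as prescribed by X: a Kaloujnine-Krasner embedding into functions from
    U(B) to M. It is built without U(B) and without the Poincare-Birkhoff-Witt
    theorem: U(B) is replaced by words in a totally ordered basis (e_j) of B, up to
    order, with the shuffle convolution, i.e. by a formal group with divided powers.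
    The product of the exponentials exp(c_j e_j) has an explicit flat
    Maurer-Cartan form, computed by recursion on words in any characteristic, and B
    acts by the invariant vector fields. Lifting the e_j to L twists this action by
    a function with values in Theta(L), which is the base part y_i.

    A convolution by functions with values in Theta(L) acts as prescribed by X: this
    follows by induction on words, since multihomogeneity makes the derivative of
    an identity an identity. *)

Require Import Defs.
From HB Require Import structures.
From mathcomp Require Import all_boot all_order all_algebra.
From mathcomp Require Import boolp classical_sets functions wochoice.
From mathcomp Require Import finmap monalg.

Set Implicit Arguments.
Unset Strict Implicit.
Unset Printing Implicit Defensive.

Import GRing.Theory.
Local Open Scope ring_scope.

(** * Linear extension, bases and orders *)

Section LinearExtension.
Variables (K : fieldType) (T : choiceType).
Implicit Types (V W : lmodType K) (g : {malg K[T]}).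

Definition linext V (F : T -> V) g : V := \sum_(k <- msupp g) g@_k *: F k.

Lemma linextEw V (F : T -> V) g (d : {fset T}) : (msupp g `<=` d)%fset ->
  linext F g = \sum_(k <- d) g@_k *: F k.
Proof.
move=> sgd; rewrite /linext; apply: big_fset_incl => // k _ kg.
by rewrite mcoeff_outdom ?scale0r.
Qed.

Fact linext_is_linear V (F : T -> V) : linear (linext F).
Proof.
move=> c f g; pose d := (msupp f `|` msupp g)%fset.
have sf : (msupp f `<=` d)%fset by apply: fsubsetUl.
have sg : (msupp g `<=` d)%fset by apply: fsubsetUr.
rewrite (linextEw F (_ : msupp _ `<=` d)%fset); last first.
  apply: (fsubset_trans (msuppD_le _ _)); rewrite fsubUset sg andbT.
  exact: fsubset_trans (msuppZ_le _ _) sf.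
rewrite (linextEw F sf) (linextEw F sg) scaler_sumr -big_split /=.
by apply: eq_bigr => k _; rewrite mcoeffD mcoeffZ scalerDl scalerA.
Qed.
HB.instance Definition _ (V : lmodType K) (F : T -> V) :=
  GRing.isLinear.Build K {malg K[T]} V *:%R (linext F) (linext_is_linear F).

Lemma linextU V (F : T -> V) k : linext F << k >> = F k.
Proof. by rewrite /linext msuppU oner_eq0 big_seq_fset1 mcoeffUU scale1r. Qed.

Lemma malg_scaleU c (k : T) : << c *g k >> = c *: << k >> :> {malg K[T]}.
Proof. by apply/malgP => k'; rewrite mcoeffZ !mcoeffU mulrnAr mulr1. Qed.

Lemma linextK g : linext (fun k => << k >> : {malg K[T]}) g = g.
Proof.
by rewrite [RHS]monalgE; apply: eq_bigr => k _; rewrite malg_scaleU.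
Qed.

Lemma linext_comp V W (h : {linear V -> W}) (F : T -> V) g :
  h (linext F g) = linext (h \o F) g.
Proof. by rewrite linear_sum; apply: eq_bigr => k _; rewrite linearZ. Qed.

Lemma eq_linext V (F F' : T -> V) g :
  {in msupp g, F =1 F'} -> linext F g = linext F' g.
Proof. by move=> e; apply: eq_big_seq => k /e ->. Qed.

Lemma linext_inj V (h h' : {linear {malg K[T]} -> V}) :
  (forall k, h << k >> = h' << k >>) -> h =1 h'.
Proof.
move=> e g; rewrite -[g]linextK !linext_comp.
by apply: eq_linext => k _; apply: e.
Qed.

End LinearExtension.

Section Basis.
Variables (K : fieldType) (B : lmodType K).

Let supported (X : set B) (g : {malg K[B]}) := forall u, u \in msupp g -> X u.
Let indep (X : set B) :=
  forall g, supported X g -> linext id g = 0 -> g = 0.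

(** Zorn's lemma on sets admitting no finitely supported relation: a vector outside the span of a
    maximal one could be adjoined to it. *)
Lemma exists_basis_set : exists X : set B, indep X /\
  forall v, exists2 g, supported X g & linext id g = v.
Proof.
have chain F : (F `<=` indep)%classic -> total_on F subset ->
    indep (\bigcup_(Y in F) Y)%classic.
  move=> Findep Ftot g sg.
  have [g0|[u0 u0g]] : g = 0 \/ exists u, u \in msupp g.
    have [g0|[u ug]] := fset_0Vmem (msupp g); last by right; exists u.
    by left; apply/malgP => u; rewrite mcoeff_outdom ?mcoeff0 // g0.
  - by rewrite g0.
  have [Y0 FY0 _] := sg _ u0g.
  (* The support is finite and the chain is total, so a single member of the chain contains all of
     it. *)
  have {u0g} [Y FY sY] : exists2 Y, F Y & supported Y g.
    suff : forall s : seq B, {subset s <= msupp g} ->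
        exists2 Y, F Y & {in s, forall u, Y u}.
      by move=> /(_ (msupp g) (fun _ => id)).
    elim=> [|u s IH] ss; first by exists Y0.
    have [Z FZ sZ] : exists2 Z, F Z & {in s, forall v, Z v}.
      by apply: IH => v vs; apply: ss; rewrite inE vs orbT.
    have [Y FY Yu] := sg _ (ss u (mem_head _ _)).
    have [YZ|ZY] := Ftot _ _ FY FZ.
      by exists Z => // v; rewrite inE => /predU1P[->|/sZ//]; apply: YZ.
    by exists Y => // v; rewrite inE => /predU1P[->//|/sZ]; apply: ZY.
  exact: (Findep _ FY).
have [X [Xi Xmax]] := Zorn_bigcup chain; exists X; split=> // v.
apply: contrapT => nv; apply: (Xmax (X `|` [set v])%classic).
  split; first by move=> u; left.
  move=> /(_ v (or_intror erefl)) Xv; apply: nv; exists << v >>; last by rewrite linextU.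
  by move=> u; rewrite msuppU oner_eq0 inE => /eqP ->.
(* Drop the [v]-coordinate of a relation [g]: if it is zero, [g] is a relation in [X]; otherwise
   dividing by it puts [v] in the span of [X]. *)
move=> g sg g0; pose g' := g - g@_v *: << v >>.
have sg' : supported X g'.
  move=> u; rewrite -mcoeff_neq0 mcoeffB mcoeffZ mcoeffU.
  have [<-|nvu] := eqVneq v u; first by rewrite mulr1 subrr eqxx.
  rewrite mulr0 subr0 mcoeff_neq0 => /sg[]// uv.
  by rewrite uv eqxx in nvu.
have eg' : linext id g' = - (g@_v *: v).
  by rewrite linearB linearZ /= g0 linextU sub0r.
have [gv0|gv0] := eqVneq g@_v 0.
  have -> : g = g' by rewrite /g' gv0 scale0r subr0.
  by apply: Xi => //; rewrite eg' gv0 scale0r oppr0.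
case: nv; exists (- (g@_v)^-1 *: g').
  by move=> u /(fsubsetP (msuppZ_le _ _))/sg'.
by rewrite linearZ /= eg' scalerN scaleNr opprK scalerA mulVf // scale1r.
Qed.

(** A basis of [B], presented by the extension of families to linear maps. *)
Lemma exists_basis : exists (J : choiceType) (e : J -> B)
    (ext : forall V : lmodType K, (J -> V) -> {linear B -> V}),
  (forall V psi j, ext V psi (e j) = psi j) /\
  (forall (V : lmodType K) (h h' : {linear B -> V}),
     (forall j, h (e j) = h' (e j)) -> h =1 h').
Proof.
have [X [Xi Xspan]] := exists_basis_set.
pose coord v := s2val (cid2 (Xspan v)).
have coordX v : supported X (coord v) := s2valP (cid2 (Xspan v)).
have coordE v : linext id (coord v) = v := s2valP' (cid2 (Xspan v)).
have coord_uniq v g : supported X g -> linext id g = v -> g = coord v.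
  move=> sg gv; apply/eqP; rewrite -subr_eq0; apply/eqP/Xi; last first.
    by rewrite linearB /= gv coordE subrr.
  by move=> u /(fsubsetP (msuppB_le _ _)); rewrite inE => /orP[/sg|/coordX].
pose J : choiceType := {x : B | `[< X x >]}.
(* Coordinates are indexed by all of [B], so [psi] is extended by a default, taken to be 0 below,
   off the basis. *)
pose fam V (psi : J -> V) (d : V) (u : B) := oapp psi d (insub u : option J).
have ext_linear (V : lmodType K) (psi : J -> V) :
    linear (fun v => linext (fam V psi 0) (coord v)).
  move=> c u v; rewrite -linearP; congr linext.
  apply/esym/coord_uniq; last by rewrite linearP /= !coordE.
  move=> x /(fsubsetP (msuppD_le _ _)); rewrite inE => /orP[|/coordX//].
  by move/(fsubsetP (msuppZ_le _ _))/coordX.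
pose ext (V : lmodType K) (psi : J -> V) : {linear B -> V} :=
  HB.pack (fun v => linext (fam V psi 0) (coord v))
    (GRing.isLinear.Build K B V *:%R _ (ext_linear V psi)).
exists J, val, ext; split=> [V psi j|V h h' e v].
  suff /= <- : << val j >> = coord (val j) by rewrite /= linextU /fam valK.
  apply: coord_uniq; last by rewrite linextU.
  by move=> x; rewrite msuppU oner_eq0 inE => /eqP ->; apply/asboolP/(valP j).
rewrite -[v]coordE !linext_comp; apply: eq_linext => u /coordX/asboolP Xu.
exact: (e (Sub u Xu)).
Qed.

End Basis.

(** The strict part of a well-order. It will fix the order in which the exponentials of basis
    elements are multiplied. *)
Lemma exists_total_order (T : choiceType) : exists lt : rel T,
  [/\ irreflexive lt, transitive lt & forall i j, i != j -> lt i j || lt j i].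
Proof.
have [R woR] := well_ordering_principle T.
have min2 i j : exists z, minimum_of R (pred2 i j) z /\
    forall z', minimum_of R (pred2 i j) z' -> z = z'.
  have [|z [zm zu]] := woR (pred2 i j); last by exists z.
  by exists i; rewrite !inE eqxx.
have Rtot i j : R i j || R j i.
  have [z [[]]] := min2 i j; rewrite !inE => /orP[]/eqP-> /(_ _ _) zm _.
    by rewrite zm // !inE eqxx orbT.
  by rewrite (zm i) ?orbT // !inE eqxx.
have Rrefl i : R i i by have := Rtot i i; rewrite orbb.
have Ranti i j : R i j -> R j i -> i = j.
  move=> ij ji; have [z [_ zu]] := min2 i j; transitivity z.
    apply/esym/zu; split; first by rewrite !inE eqxx.
    by move=> k; rewrite !inE => /orP[]/eqP->.
  apply: zu; split; first by rewrite !inE eqxx orbT.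
  by move=> k; rewrite !inE => /orP[]/eqP->.
have Rtrans : transitive R.
  (* Transitivity is read off the least of the three elements. *)
  move=> j i k ij jk; have [|z [[zin zm] _]] := woR (mem [:: i; j; k]).
    by exists i; rewrite !inE eqxx.
  move: (zm i) (zm j) (zm k) zin; rewrite !inE !eqxx ?orbT => zi zj zk.
  case/or3P=> /eqP ez; subst z.
  - exact: zk.
  - by rewrite (Ranti i j ij (zi isT)).
  - by rewrite -(Ranti j k jk (zj isT)).
exists (fun i j => (i != j) && R i j); split=> [i|j i k|i j nij].
- by rewrite eqxx.
- move=> /andP[nij ij] /andP[njk jk]; rewrite (Rtrans j) // andbT.
  apply: contra nij => /eqP ik; subst k; apply/eqP; exact: Ranti.
- by rewrite nij eq_sym nij; apply: Rtot.
Qed.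

(** * Shuffle convolution of functions on words *)

Section ShuffleConvolution.
Variable J : Type.

(** A function on words is read as a formal divided power series: its value at [w] is the iterated
    partial derivative at the origin along the letters of [w]. Then [splits] lists the terms of the
    Leibniz rule, [conv] is the product of series and [shift j] the partial derivative along [j]. *)
Fixpoint splits (w : seq J) : seq (seq J * seq J) :=
  if w is j :: w' then
    [seq (j :: p.1, p.2) | p <- splits w'] ++ [seq (p.1, j :: p.2) | p <- splits w']
  else [:: ([::], [::])].

Definition conv (U V : Type) (W : zmodType) (mu : U -> V -> W)
    (f : seq J -> U) (g : seq J -> V) (w : seq J) : W :=
  \sum_(p <- splits w) mu (f p.1) (g p.2).

Definition shift (U : Type) (j : J) (f : seq J -> U) : seq J -> U :=
  fun w => f (j :: w).

Section Conv.
Variables (U V : Type) (W : zmodType) (mu : U -> V -> W).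
Implicit Types (f : seq J -> U) (g : seq J -> V).

Lemma conv_nil f g : conv mu f g [::] = mu (f [::]) (g [::]).
Proof. by rewrite /conv big_seq1. Qed.

Lemma conv_cons f g j w :
  conv mu f g (j :: w) = conv mu (shift j f) g w + conv mu f (shift j g) w.
Proof. by rewrite /conv big_cat !big_map. Qed.

Lemma eq_conv f f' g g' w :
    (forall u, size u <= size w -> f u = f' u)%N ->
    (forall u, size u <= size w -> g u = g' u)%N ->
  conv mu f g w = conv mu f' g' w.
Proof.
elim: w f f' g g' => [|j w IH] f f' g g' ef eg.
  by rewrite !conv_nil ef ?eg.
rewrite !conv_cons; congr (_ + _); apply: IH => u su.
- exact: ef.
- by apply: eg; apply: leqW.
- by apply: ef; apply: leqW.
- exact: eg.
Qed.

(** Only the splitting that gives all of [w] to [f] sees [f] at full length, and it pairs that value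
    with [g [::]]. This makes fixed point equations well founded. *)
Lemma eq_conv_lt f f' g w : (forall u, mu u (g [::]) = 0) ->
    (forall u, size u < size w -> f u = f' u)%N ->
  conv mu f g w = conv mu f' g w.
Proof.
move=> g0; elim: w f f' => [|j w IH] f f' ef; first by rewrite !conv_nil !g0.
rewrite !conv_cons; congr (_ + _); first by apply: IH => u su; apply: ef.
by apply: eq_conv => // u su; apply: ef.
Qed.

End Conv.

Lemma convC (U V : Type) (W : zmodType) (mu : U -> V -> W) f g w : conv mu f g w = conv (fun v u => mu u v) g f w.
Proof.
elim: w f g => [|j w IH] f g; first by rewrite !conv_nil.
by rewrite !conv_cons addrC; congr (_ + _); apply: IH.
Qed.

Lemma conv_comp (U V : Type) (W W' : zmodType) (mu : U -> V -> W) (h : W -> W')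
    f g w : {morph h : x y / x + y} ->
  h (conv mu f g w) = conv (fun u v => h (mu u v)) f g w.
Proof.
move=> hD; elim: w f g => [|j w IH] f g; first by rewrite !conv_nil.
by rewrite !conv_cons hD; congr (_ + _); apply: IH.
Qed.


Lemma convDl (U W : zmodType) (V : Type) (mu : U -> V -> W) f f' g w :
    (forall v, {morph mu^~ v : x y / x + y}) ->
  conv mu (fun u => f u + f' u) g w = conv mu f g w + conv mu f' g w.
Proof. by move=> muD; rewrite -big_split; apply: eq_bigr => p _; apply: muD. Qed.

Lemma convDr (V W : zmodType) (U : Type) (mu : U -> V -> W) f g g' w :
    (forall u, {morph mu u : x y / x + y}) ->
  conv mu f (fun u => g u + g' u) w = conv mu f g w + conv mu f g' w.
Proof. by move=> muD; rewrite -big_split; apply: eq_bigr => p _; apply: muD. Qed.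

Lemma conv_linear_l (K : fieldType) (U W : lmodType K) (V : Type)
    (mu : U -> V -> W) c f f' g w : (forall v, linear (mu^~ v)) ->
  conv mu (fun u => c *: f u + f' u) g w = c *: conv mu f g w + conv mu f' g w.
Proof.
move=> mul; rewrite scaler_sumr -big_split; apply: eq_bigr => p _; exact: mul.
Qed.

Lemma conv_linear_r (K : fieldType) (V W : lmodType K) (U : Type)
    (mu : U -> V -> W) c f g g' w : (forall u, linear (mu u)) ->
  conv mu f (fun u => c *: g u + g' u) w = c *: conv mu f g w + conv mu f g' w.
Proof.
move=> mul; rewrite scaler_sumr -big_split; apply: eq_bigr => p _; exact: mul.
Qed.

(** The bound on the length allows symmetry to be proved by induction on the degree. *)
Definition symmetric_upto (U : Type) (n : nat) (f : seq J -> U) :=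
  forall u i j v, (size (u ++ i :: j :: v) < n)%N ->
    f (u ++ i :: j :: v) = f (u ++ j :: i :: v).

Definition symmetric_word (U : Type) (f : seq J -> U) :=
  forall u i j v, f (u ++ i :: j :: v) = f (u ++ j :: i :: v).

Lemma symmetric_word_upto (U : Type) (f : seq J -> U) :
  symmetric_word f <-> forall n, symmetric_upto n f.
Proof.
split=> [sf n u i j v _|sf u i j v]; first exact: sf.
exact: sf _ _ _ _ _ (ltnSn _).
Qed.

Lemma shift_upto (U : Type) n (f : seq J -> U) j :
  symmetric_upto n f -> symmetric_upto n.-1 (shift j f).
Proof.
move=> sf u i k v; rewrite ltn_predRL => su.
exact: (sf (j :: u)).
Qed.

Lemma symmetric_uptoW (U : Type) m n (f : seq J -> U) : (m <= n)%N ->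
  symmetric_upto n f -> symmetric_upto m f.
Proof. by move=> mn sf u i j v su; apply: sf; apply: leq_trans mn. Qed.

Section ConvSymmetric.
Variables (U V : Type) (W : zmodType) (mu : U -> V -> W).
Implicit Types (f : seq J -> U) (g : seq J -> V).

Lemma conv_symmetric_upto n f g : symmetric_upto n f -> symmetric_upto n g ->
  symmetric_upto n (conv mu f g).
Proof.
move=> sf sg u; elim: u n f g sf sg => [|l u IH] n f g sf sg i j v su.
  have e (T : Type) (h : seq J -> T) : symmetric_upto n h ->
      forall w, (size w <= size v)%N ->
      shift j (shift i h) w = shift i (shift j h) w.
    by move=> sh w sw; apply: (sh [::]); apply: leq_ltn_trans su.
  rewrite !conv_cons [LHS]addrACA; congr (_ + _ + (_ + _)).
    by apply: eq_conv => // w; apply: e.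
  by apply: eq_conv => // w; apply: e.
have snl (T : Type) (h : seq J -> T) : symmetric_upto n h -> symmetric_upto n.-1 h.
  exact/symmetric_uptoW/leq_pred.
rewrite /= !conv_cons; congr (_ + _).
  by apply: (IH n.-1); [exact: shift_upto|exact: snl|rewrite ltn_predRL].
by apply: (IH n.-1); [exact: snl|exact: shift_upto|rewrite ltn_predRL].
Qed.

Lemma conv_symmetric f g : symmetric_word f -> symmetric_word g ->
  symmetric_word (conv mu f g).
Proof.
move=> /symmetric_word_upto sf /symmetric_word_upto sg.
by apply/symmetric_word_upto => n; apply: conv_symmetric_upto.
Qed.

(** The annihilating constant term of [g] gains one degree, as in [eq_conv_lt]. *)
Lemma conv_symmetric_lt n f g : (forall u, mu u (g [::]) = 0) ->
  symmetric_upto n f -> symmetric_word g -> symmetric_upto n.+1 (conv mu f g).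
Proof.
move=> g0 sf sg u; elim: u n f sf => [|l u IH] n f sf i j v.
  rewrite ltnS /= => su.
  rewrite !conv_cons [LHS]addrACA; congr (_ + _ + (_ + _)).
    by apply: eq_conv_lt => // w sw; apply: (sf [::]); apply: leq_ltn_trans su.
  by apply: eq_conv => // w _; apply: (sg [::]).
move=> su; rewrite /= !conv_cons; congr (_ + _).
  have n0 : (0 < n)%N by case: n su sf.
  by rewrite -(prednK n0) in su sf *; apply: (IH n.-1) => //; exact: (@shift_upto _ n.-1.+1).
apply: (conv_symmetric_upto sf) => //.
by move=> u' i' j' v' _; apply: (sg (l :: u')).
Qed.

End ConvSymmetric.

(** The [n]-th iterate of [Phi] is already stationary on words shorter than [n]. *)
Lemma word_rec (U : Type) (Phi : (seq J -> U) -> seq J -> U) (d : U) :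
    (forall f f' w, (forall u, size u < size w -> f u = f' u)%N ->
      Phi f w = Phi f' w) ->
  exists f, forall w, f w = Phi f w.
Proof.
move=> PhiE; pose F n := iter n Phi (fun _ => d).
have FE m n w : (size w < m)%N -> (size w < n)%N -> F m w = F n w.
  elim: m n w => // m IH [//|n] w; rewrite !ltnS => wm wn /=.
  by apply: PhiE => u su; apply: IH; [apply: leq_trans wm|apply: leq_trans wn].
exists (fun w => F (size w).+1 w) => w /=.
by apply: PhiE => u su; apply: (FE (size w) (size u).+1).
Qed.

(** A formal initial value problem prescribing all first partial derivatives. Words are ordered, so
    a solution always exists; integrability reappears as the question whether this solution is
    symmetric. *)
Lemma word_ode (U : Type) (u0 : U) (Phi : J -> (seq J -> U) -> seq J -> U) :
    (forall j f f' w, (forall u, size u <= size w -> f u = f' u)%N ->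
      Phi j f w = Phi j f' w) ->
  exists2 f, f [::] = u0 & forall j w, f (j :: w) = Phi j f w.
Proof.
move=> PhiE; pose Psi f w := if w is j :: w' then Phi j f w' else u0.
have [|f fE] := @word_rec U Psi u0.
  by move=> f f' [//|j w] e; apply: PhiE => u su; apply: e.
by exists f => [|j w]; rewrite fE.
Qed.

Lemma word_ode_uniq (U : Type) (Phi : J -> (seq J -> U) -> seq J -> U) f f' :
    (forall j g g' w, (forall u, size u <= size w -> g u = g' u)%N ->
      Phi j g w = Phi j g' w) ->
    f [::] = f' [::] -> (forall j w, f (j :: w) = Phi j f w) ->
    (forall j w, f' (j :: w) = Phi j f' w) ->
  f =1 f'.
Proof.
move=> PhiE e0 fE f'E w.
have [n] := ubnP (size w); elim: n w => // n IH [//|j w] sw.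
by rewrite fE f'E; apply: PhiE => u su; apply: IH; exact: leq_ltn_trans su sw.
Qed.

End ShuffleConvolution.

(** * The Maurer-Cartan form of a product of exponentials *)

Section LieFacts.
Variable K : fieldType.

Section LinearMorph.
Variables (U V : lmodType K) (f : U -> V) (fl : linear f).

Lemma linear_morphD : {morph f : x y / x + y}.
Proof. by move=> x y; have := fl 1 x y; rewrite !scale1r. Qed.

Lemma linear_morph0 : f 0 = 0.
Proof. by have /eqP := linear_morphD 0 0; rewrite addr0 -subr_eq0 opprD addNKr oppr_eq0 => /eqP. Qed.

Lemma linear_morphZ c : {morph f : x / c *: x}.
Proof. by move=> x; have := fl c x 0; rewrite linear_morph0 !addr0. Qed.

Lemma linear_morphN : {morph f : x / - x}.
Proof. by move=> x; rewrite -scaleN1r linear_morphZ scaleN1r. Qed.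

Lemma linear_morphB : {morph f : x y / x - y}.
Proof. by move=> x y; rewrite linear_morphD linear_morphN. Qed.

End LinearMorph.

Lemma lie0l (A : lieAlgType K) (z : A) : lie 0 z = 0.
Proof. exact: linear_morph0 (lie_linearl z). Qed.
Lemma lie0r (A : lieAlgType K) (z : A) : lie z 0 = 0.
Proof. exact: linear_morph0 (lie_linearr z). Qed.
Lemma lieBl (A : lieAlgType K) (z : A) : {morph (fun x => lie x z) : x y / x - y}.
Proof. exact: linear_morphB (lie_linearl z). Qed.
Lemma lieBr (A : lieAlgType K) (z : A) : {morph lie z : x y / x - y}.
Proof. exact: linear_morphB (lie_linearr z). Qed.

Lemma pactDl (P : liePair K) a : {morph (fun w => @pact K P w a) : x y / x + y}.
Proof. exact: linear_morphD (pact_linearl a). Qed.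
Lemma pactDr (P : liePair K) w : {morph @pact K P w : x y / x + y}.
Proof. exact: linear_morphD (pact_linearr w). Qed.

Fact adPair_lie (A : lieAlgType K) (w a b : A) :
  lie w (lie a b) = lie (lie w a) b - lie (lie w b) a.
Proof.
have /eqP := lie_jacobi w a b.
rewrite (lieC (lie w a) b) (lieC (lie w b) a) opprK (lieC b w).
rewrite (linear_morphN (lie_linearr a)) -addrA addr_eq0 => /eqP ->.
by rewrite opprD opprK addrC.
Qed.

Definition adPair (A : lieAlgType K) : liePair K :=
  LiePair (@lie_linearl K A) (@lie_linearr K A) (@adPair_lie A).

Fact adHom_act (A A' : lieAlgType K) (h : lieHom A A') (w : pmod (adPair A))
    (a : palg (adPair A)) :
  h (@pact K (adPair A) w a) = @pact K (adPair A') (h w) (h a).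
Proof. exact: lhom_lie. Qed.

Definition adHom (A A' : lieAlgType K) (h : lieHom A A') :
    pairHom (adPair A) (adPair A') :=
  @PairHom K (adPair A) (adPair A') h h (adHom_act h).

End LieFacts.

(** * Convolution of functions with values in a pair *)

Section ConvLie.
Variables (K : fieldType) (J : Type).

Lemma shift_conv (U V : Type) (W : zmodType) (mu : U -> V -> W) (j : J) f g :
  shift j (conv mu f g) =
  (fun w => conv mu (shift j f) g w + conv mu f (shift j g) w).
Proof. by apply/funext => w; rewrite /shift conv_cons. Qed.

(** Each derivative falls on one of three factors, so the module axiom passes from values to
    functions by induction on the word. *)
Lemma conv_pact_lie (P : liePair K) (f : seq J -> pmod P)
    (g h : seq J -> palg P) w :
  conv (@pact K P) f (conv lie g h) w =
  conv (@pact K P) (conv (@pact K P) f g) h w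
    - conv (@pact K P) (conv (@pact K P) f h) g w.
Proof.
elim: w f g h => [|j w IH] f g h; first by rewrite !conv_nil pact_lie.
rewrite !conv_cons !shift_conv (convDr _ _ _ _ (@pactDr K P)).
rewrite !(convDl _ _ _ _ (@pactDl K P)) !IH.
set x1 := conv _ (conv _ (shift j f) g) h w.
set x2 := conv _ (conv _ f (shift j g)) h w.
set x3 := conv _ (conv _ f g) (shift j h) w.
set y1 := conv _ (conv _ (shift j f) h) g w.
set y2 := conv _ (conv _ f h) (shift j g) w.
set y3 := conv _ (conv _ f (shift j h)) g w.
by rewrite addrA (addrACA x1) (addrACA (x1 + x2)) -!opprD (addrAC y1).
Qed.

Lemma conv_lieC (A : lieAlgType K) (f g : seq J -> A) w :
  conv lie f g w = - conv lie g f w.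
Proof.
rewrite convC /conv -sumrN.
by apply: eq_bigr => p _; rewrite lieC.
Qed.

(** The two Leibniz terms cancel by antisymmetry, and only the constant term uses [liexx]; this
    covers characteristic 2. *)
Lemma conv_liexx (A : lieAlgType K) (f : seq J -> A) w : conv lie f f w = 0.
Proof.
elim: w f => [|j w IH] f; first by rewrite conv_nil liexx.
by rewrite conv_cons conv_lieC addNr.
Qed.

Lemma hom_conv_pact (P Q : liePair K) (h : pairHom P Q) (f : seq J -> pmod P)
    (g : seq J -> palg P) w :
  hmod h (conv (@pact K P) f g w) =
  conv (@pact K Q) (hmod h \o f) (halg h \o g) w.
Proof. by rewrite /conv linear_sum; apply: eq_bigr => p _; rewrite hact. Qed.

End ConvLie.

Section MaurerCartan.
Variables (K : fieldType) (J : choiceType) (lt : rel J).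
Hypotheses (lt_irr : irreflexive lt) (lt_trans : transitive lt).
Hypothesis lt_total : forall i j, i != j -> lt i j || lt j i.

Section Form.
Variables (A : lieAlgType K) (a : J -> A).

(* The logarithmic derivative along the i-th coordinate of the product, taken
   in increasing order of j, of the exponentials exp(c_j a_j); it is written
   as a function on words, words being the symbols of divided power monomials. *)
Lemma exists_mc_form : exists2 th : seq J -> J -> A, th [::] = a &
  forall j w i, th (j :: w) i =
    if lt i j then conv lie (th^~ i) (th^~ j) w else 0.
Proof.
pose Phi j (f : seq J -> J -> A) w i :=
  if lt i j then conv lie (f^~ i) (f^~ j) w else 0.
have [|th th0 thS] := @word_ode J _ a Phi.
  move=> j f f' w e; apply/funext => i; rewrite /Phi; case: ifP => // _.
  by apply: eq_conv => u /e ->.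
by exists th => // j w i; rewrite thS.
Qed.

Definition mc_form (i : J) (w : seq J) : A := s2val (cid2 exists_mc_form) w i.

Lemma mc_form0 i : mc_form i [::] = a i.
Proof. by rewrite /mc_form (s2valP (cid2 exists_mc_form)). Qed.

Lemma mc_formS i j w : mc_form i (j :: w) =
  if lt i j then conv lie (mc_form i) (mc_form j) w else 0.
Proof. exact: (s2valP' (cid2 exists_mc_form)). Qed.

(** The Maurer-Cartan equation. For distinct indices exactly one of the two derivatives can be
    nonzero, and it is the bracket by construction. *)
Lemma mc_form_flat i j w :
  mc_form i (j :: w) - mc_form j (i :: w) = conv lie (mc_form i) (mc_form j) w.
Proof.
rewrite !mc_formS; have [<-|nij] := eqVneq i j.
  by rewrite lt_irr subrr conv_liexx.
have [ij|nlt] := boolP (lt i j); last first.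
  have := lt_total nij; rewrite (negPf nlt) /= => ->.
  by rewrite [in RHS]conv_lieC sub0r.
have -> : lt j i = false.
  by apply/negP => ji; have := lt_irr i; rewrite (lt_trans ij ji).
by rewrite subr0.
Qed.

End Form.

(** These are the two mixed second derivatives of a solution of a system [df = f g]; their
    difference is the curvature applied to [f]. *)
Lemma flat_swap (P : liePair K) (f : seq J -> pmod P)
    (g h : seq J -> palg P) i j w :
    (forall u, g (j :: u) - h (i :: u) = conv lie g h u) ->
  conv (@pact K P) (conv (@pact K P) f g) h w
    + conv (@pact K P) f (shift i h) w =
  conv (@pact K P) (conv (@pact K P) f h) g w
    + conv (@pact K P) f (shift j g) w.
Proof.
move=> flat; have -> : conv (@pact K P) f (shift j g) w =
    conv (@pact K P) f (fun u => conv lie g h u + shift i h u) w.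
  by apply: eq_conv => // u _; rewrite -flat addrNK.
rewrite (convDr _ _ _ _ (@pactDr K P)) conv_pact_lie.
set X := conv _ (conv _ f g) h w; set Y := conv _ (conv _ f h) g w.
by rewrite (addrA Y) [Y + _]addrC subrK.
Qed.

(** Here [f] follows a flat connection in the directions of [p] and is constant in the others.
    Flatness exchanges the first two letters; later exchanges come from the symmetry of the
    convolution one degree lower. *)
Lemma symmetric_of_flow (P : liePair K) (f : seq J -> pmod P)
    (g : J -> seq J -> palg P) n (p : pred J) :
    (forall i j u, g i (j :: u) - g j (i :: u) = conv lie (g i) (g j) u) ->
    (forall i, symmetric_upto n (g i)) ->
    (forall j w, f (j :: w) = if p j then conv (@pact K P) f (g j) w else 0) ->
    (forall i j w, p i -> ~~ p j -> g i (j :: w) = 0) ->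
  symmetric_upto n.+1 f.
Proof.
move=> flat gs fE pE.
have sf m : (m <= n.+1)%N -> symmetric_upto m f.
  elim: m => [|m IH] mn [|l u] i j v su //=.
    rewrite !fE; case: ifPn => pi; case: ifPn => pj.
    - rewrite !conv_cons.
      rewrite (_ : shift j f = conv (@pact K P) f (g j)); last first.
        by apply/funext => w; rewrite /shift fE pj.
      rewrite (_ : shift i f = conv (@pact K P) f (g i)); last first.
        by apply/funext => w; rewrite /shift fE pi.
      exact/esym/flat_swap.
    (* Both [f] and [g i] are constant along [j], so both mixed derivatives vanish. *)
    - rewrite conv_cons.
      have -> : shift j f = fun=> 0.
        by apply/funext => w; rewrite /shift fE (negPf pj).
      have -> : shift j (g i) = fun=> 0.
        by apply/funext => w; rewrite /shift pE.
      rewrite /conv !big1 ?addr0 // => q _.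
        exact: (linear_morph0 (pact_linearr _)).
      exact: (linear_morph0 (pact_linearl _)).
    - rewrite conv_cons.
      have -> : shift i f = fun=> 0.
        by apply/funext => w; rewrite /shift fE (negPf pi).
      have -> : shift i (g j) = fun=> 0.
        by apply/funext => w; rewrite /shift pE.
      rewrite /conv !big1 ?addr0 // => q _.
        exact: (linear_morph0 (pact_linearr _)).
      exact: (linear_morph0 (pact_linearl _)).
    - by [].
  rewrite !fE; case: ifP => // _.
  apply: (@conv_symmetric_upto _ _ _ _ _ m) => //.
  - by apply: IH; apply: ltnW.
  - by apply: symmetric_uptoW (gs l).
exact: sf.
Qed.

(** Each component of the form is itself a flow under the adjoint action, driven by the components
    of larger index, so symmetry of all components climbs one degree at a time. *)
Lemma mc_form_symmetric (A : lieAlgType K) (a : J -> A) i :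
  symmetric_word (mc_form a i).
Proof.
apply/symmetric_word_upto => n; elim: n i => [|n IH] i; first by move=> ? ? ? ?.
apply: (@symmetric_of_flow (adPair A) _ (mc_form a) n (lt i)) => //.
- exact: mc_form_flat.
- by move=> j w; rewrite mc_formS.
- move=> k j w ik; apply: contraNeq; rewrite mc_formS.
  by case: ifP => [kj _|]; rewrite ?eqxx // (lt_trans ik kj).
Qed.

Lemma mc_form_hom (A A' : lieAlgType K) (h : lieHom A A') (a : J -> A) i w :
  h (mc_form a i w) = mc_form (h \o a) i w.
Proof.
have [n] := ubnP (size w); elim: n i w => // n IH i [|j w] sw.
  by rewrite !mc_form0.
rewrite !mc_formS; case: ifP => _; last by rewrite linear0.
have := hom_conv_pact (adHom h) (mc_form a i) (mc_form a j) w => /= ->.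
by apply: eq_conv => u su /=; apply: IH; exact: leq_ltn_trans su sw.
Qed.

Section Flow.
Variables (P : liePair K) (a : J -> palg P).

Lemma exists_flow (m : pmod P) : exists2 f : seq J -> pmod P, f [::] = m &
  forall j w, f (j :: w) = conv (@pact K P) f (mc_form a j) w.
Proof. by apply: word_ode => j f f' w e; apply: eq_conv. Qed.

(** The orbit map [m g], where [g] is the ordered product of the exponentials of the [c_j a_j]. *)
Definition flow (m : pmod P) : seq J -> pmod P := s2val (cid2 (exists_flow m)).

Lemma flow0 m : flow m [::] = m.
Proof. exact: (s2valP (cid2 (exists_flow m))). Qed.

Lemma flowS m j w :
  flow m (j :: w) = conv (@pact K P) (flow m) (mc_form a j) w.
Proof. exact: (s2valP' (cid2 (exists_flow m))). Qed.

Lemma flow_uniq m (f : seq J -> pmod P) : f [::] = m ->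
  (forall j w, f (j :: w) = conv (@pact K P) f (mc_form a j) w) -> f =1 flow m.
Proof.
move=> f0 fS; apply: (@word_ode_uniq _ _
  (fun j g => conv (@pact K P) g (mc_form a j))) => //.
- by move=> j g g' w e; apply: eq_conv.
- by rewrite flow0.
- exact: flowS.
Qed.

Lemma flow_linear w : linear (fun m => flow m w).
Proof.
move=> c m m'; apply/esym.
apply: (@flow_uniq _ (fun w => c *: flow m w + flow m' w)); first by rewrite !flow0.
by move=> j u; rewrite !flowS conv_linear_l //; apply: pact_linearl.
Qed.

Lemma flow_symmetric m : symmetric_word (flow m).
Proof.
apply/symmetric_word_upto => n.
apply: (@symmetric_uptoW _ _ n n.+1) => //.
apply: (@symmetric_of_flow P _ (mc_form a) n predT) => //.
- exact: mc_form_flat.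
- move=> i; apply: (symmetric_word_upto _).1; exact: mc_form_symmetric.
- exact: flowS.
Qed.

End Flow.

Lemma flow_hom (P Q : liePair K) (h : pairHom P Q) (a : J -> palg P) m w :
  hmod h (flow a m w) = flow (halg h \o a) (hmod h m) w.
Proof.
apply: (@flow_uniq _ _ _ (hmod h \o flow a m)) => [|j u] /=.
  by rewrite flow0.
rewrite flowS hom_conv_pact; apply: eq_conv => // v _ /=; exact: mc_form_hom.
Qed.

(** Conjugation by the product of exponentials. *)
Definition adflow (A : lieAlgType K) (a : J -> A) : A -> seq J -> A :=
  @flow (adPair A) a.

(** Formally [(m b) g = (m g) (g^-1 b g)]: both sides solve the same initial value problem. *)
Lemma flow_act (P : liePair K) (a : J -> palg P) m b w :
  flow a (pact m b) w = conv (@pact K P) (flow a m) (adflow a b) w.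
Proof.
apply/esym/flow_uniq; first by rewrite conv_nil /adflow !flow0.
move=> j u; rewrite conv_cons.
rewrite (_ : shift j (flow a m) = conv (@pact K P) (flow a m) (mc_form a j));
  last by apply/funext => v; rewrite /shift flowS.
rewrite (_ : shift j (adflow a b) = conv lie (adflow a b) (mc_form a j));
  last by apply/funext => v; rewrite /shift /adflow flowS.
by rewrite conv_pact_lie addrC subrK.
Qed.

End MaurerCartan.

(** * Invariant vector fields *)

Section VectorFields.
Variables (K : fieldType) (J : choiceType) (lt : rel J).
Hypotheses (lt_irr : irreflexive lt) (lt_trans : transitive lt).
Hypothesis lt_total : forall i j, i != j -> lt i j || lt j i.
Variables (B : lieAlgType K) (e : J -> B).
Variable ext : forall V : lmodType K, (J -> V) -> {linear B -> V}.
Hypothesis extE : forall (V : lmodType K) (psi : J -> V) j, ext psi (e j) = psi j.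
Hypothesis ext_eq : forall (V : lmodType K) (h h' : {linear B -> V}),
  (forall j, h (e j) = h' (e j)) -> h =1 h'.

Lemma ext_unique (V : lmodType K) (h : B -> V) (psi : J -> V) v : linear h ->
  (forall j, h (e j) = psi j) -> h v = ext psi v.
Proof.
move=> hl hE.
pose h' : {linear B -> V} := HB.pack h (GRing.isLinear.Build K B V *:%R h hl).
by apply: (@ext_eq V h') => j; rewrite extE -hE.
Qed.

Lemma ext_linear (V : lmodType K) v : linear (fun psi : J -> V => ext psi v).
Proof.
move=> c psi psi'; apply/esym.
apply: (@ext_unique V (fun v => c *: ext psi v + ext psi' v)) => [d x y|j].
  rewrite (linearP (ext psi)) (linearP (ext psi')) !scalerDr addrACA.
  by rewrite !scalerA mulrC.
by rewrite !extE.
Qed.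

Lemma ext_comp (V W : lmodType K) (g : V -> W) (psi : J -> V) v : linear g ->
  g (ext psi v) = ext (fun j => g (psi j)) v.
Proof.
move=> gl; apply: (@ext_unique W (fun v => g (ext psi v))) => [d x y|j].
  by rewrite linearP gl.
by rewrite extE.
Qed.

Lemma ext_swap (V : lmodType K) (Phi : J -> J -> V) v v' :
  ext (fun j => ext (Phi j) v) v' = ext (fun i => ext (Phi^~ i) v') v.
Proof.
apply/esym.
apply: (@ext_unique V (fun v' => ext (fun i => ext (Phi^~ i) v') v)).
  move=> c x y; rewrite -[RHS](ext_linear v); congr (ext _ v).
  by apply/funext => i; rewrite linearP.
by move=> j; congr (ext _ v); apply/funext => i; rewrite extE.
Qed.

(* The value on the vector field [f] of the one-form [Phi]. *)
Definition contract (V : lmodType K) (f : seq J -> B) (Phi : seq J -> J -> V) :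
    seq J -> V :=
  conv (fun v psi => ext psi v) f Phi.

Definition grad (V : Type) (phi : seq J -> V) : seq J -> J -> V :=
  fun w j => phi (j :: w).

(** Contraction with a vector field is linear over functions; this is associativity of convolution,
    proved letter by letter. *)
Lemma contract_conv_l (U W : lmodType K) (T : Type) (mu : U -> T -> W)
    (f : seq J -> B) (Phi : seq J -> J -> U) (g : seq J -> T) w :
    (forall t, linear (mu^~ t)) ->
  contract f (fun u j => conv mu (Phi^~ j) g u) w = conv mu (contract f Phi) g w.
Proof.
move=> mul; rewrite /contract.
elim: w f Phi g => [|j w IH] f Phi g.
  rewrite !conv_nil; under eq_fun do rewrite conv_nil.
  by rewrite (ext_comp _ _ (mul (g [::]))).
rewrite !conv_cons IH !shift_conv convDl; last first.
  by move=> t; apply: linear_morphD.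
rewrite -addrA; congr (_ + _); rewrite -!IH -convDr; last first.
  by move=> v; apply: linear_morphD; apply: ext_linear.
apply: eq_conv => // u _; apply/funext => i /=.
by rewrite /shift conv_cons.
Qed.

Lemma contract_conv_r (U W : lmodType K) (T : Type) (mu : T -> U -> W)
    (f : seq J -> B) (Phi : seq J -> J -> U) (g : seq J -> T) w :
    (forall t, linear (mu t)) ->
  contract f (fun u j => conv mu g (Phi^~ j) u) w = conv mu g (contract f Phi) w.
Proof.
move=> mul; rewrite [RHS]convC -contract_conv_l //.
by apply: eq_conv => // u _; apply/funext => j; rewrite convC.
Qed.

Lemma contract_swap (V : lmodType K) (f g : seq J -> B)
    (Phi : seq J -> J -> J -> V) w :
  contract f (fun u i => contract g (fun u' => Phi u' i) u) w =
  contract g (fun u j => contract f (fun u' i => Phi u' i j) u) w.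
Proof.
rewrite /contract; elim: w f g Phi => [|l w IH] f g Phi.
  rewrite !conv_nil; under eq_fun do rewrite conv_nil.
  under [in RHS]eq_fun do rewrite conv_nil.
  exact: ext_swap.
have extD v := linear_morphD (@ext_linear V v).
have split (f' g' : seq J -> B) (Psi : seq J -> J -> J -> V) :
    conv (fun v psi => ext psi v) f' (shift l (fun u i =>
      conv (fun v psi => ext psi v) g' (fun u' => Psi u' i) u)) w =
    conv (fun v psi => ext psi v) f' (fun u i =>
      conv (fun v psi => ext psi v) (shift l g') (fun u' => Psi u' i) u) w +
    conv (fun v psi => ext psi v) f' (fun u i =>
      conv (fun v psi => ext psi v) g' (fun u' => shift l Psi u' i) u) w.
  rewrite -convDr //; apply: eq_conv => // u _; apply/funext => i /=.
  by rewrite /shift conv_cons.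
rewrite !conv_cons split (split g f (fun u' j i => Phi u' i j)).
by rewrite (IH (shift l f)) (IH f (shift l g)) (IH f g (shift l Phi)) addrCA.
Qed.

Lemma contract_symmetric (V : lmodType K) f (Phi : seq J -> J -> V) :
  symmetric_word f -> symmetric_word Phi -> symmetric_word (contract f Phi).
Proof. exact: conv_symmetric. Qed.

Lemma grad_symmetric (V : Type) (phi : seq J -> V) :
  symmetric_word phi -> symmetric_word (grad phi).
Proof. by move=> s u i j v; apply/funext => k; apply: (s (k :: u)). Qed.

Definition mcm : seq J -> J -> B := fun w i => mc_form lt e i w.

(** The Maurer-Cartan form without its constant term. *)
Let mcm_pos w := if w is [::] then (0 : J -> B) else mcm w.

Lemma contractB (V : lmodType K) f (Phi Psi : seq J -> J -> V) w :
  contract f (fun u => Phi u - Psi u) w = contract f Phi w - contract f Psi w.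
Proof.
have := conv_linear_r (-1) f Psi Phi w (mu := fun v psi => ext psi v)
  (fun v => @ext_linear V v).
rewrite scaleN1r addrC -/(contract _ _) -/(contract _ _) => <-.
by apply: eq_conv => // u _; rewrite scaleN1r addrC.
Qed.

(** At the origin the form is the identity of [B], so contracting with it is the identity plus an
    operator strictly triangular for the length of words. *)
Lemma contract_mcmE f w : contract f mcm w = f w + contract f mcm_pos w.
Proof.
pose mc0 (w : seq J) := if w is [::] then e else (0 : J -> B).
have -> : mcm = fun w => mc0 w + mcm_pos w.
  apply/funext => -[|j u]; rewrite /mc0 /mcm_pos ?addr0 ?add0r //.
  by apply/funext => i; rewrite /mcm mc_form0.
rewrite /contract convDr; last by move=> v; apply: linear_morphD; apply: ext_linear.
congr (_ + _); elim: w f => [|j w IH] f.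
  by rewrite conv_nil; apply/esym/(@ext_unique B id).
rewrite conv_cons IH {1}/shift [X in _ + X](_ : _ = 0) ?addr0 //.
rewrite /conv big1 // => p _.
exact: (linear_morph0 (@ext_linear B _)).
Qed.

Let mcm_pos_killed v : ext (mcm_pos [::]) v = 0.
Proof. exact: (linear_morph0 (@ext_linear B v)). Qed.

(** A unipotent triangular operator is inverted by recursion on the length of words. *)
Lemma contract_mcm_onto (A : seq J -> B) : exists f, contract f mcm =1 A.
Proof.
have [|f fE] := @word_rec J B (fun f w => A w - contract f mcm_pos w) 0.
  by move=> f f' w eq; congr (_ - _); apply: eq_conv_lt.
by exists f => w; rewrite contract_mcmE {1}fE subrK.
Qed.

Lemma contract_mcm_inj f f' : contract f mcm =1 contract f' mcm -> f =1 f'.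
Proof.
move=> eff' w; have [n] := ubnP (size w); elim: n w => // n IH w sw.
have := eff' w; rewrite !contract_mcmE [X in _ + X](_ : _ = contract f' mcm_pos w).
  exact: addIr.
by apply: eq_conv_lt => // u su; apply: IH; exact: leq_trans su sw.
Qed.

Lemma contract_mcm_symmetric f :
  symmetric_word (contract f mcm) -> symmetric_word f.
Proof.
move=> sA; apply/symmetric_word_upto; elim=> [|n IH]; first by move=> ? ? ? ?.
have fE w : f w = contract f mcm w - contract f mcm_pos w.
  by rewrite contract_mcmE addrK.
have spos : symmetric_word mcm_pos.
  move=> u i j v; have : mcm (u ++ i :: j :: v) = mcm (u ++ j :: i :: v).
    by apply/funext => k; apply: mc_form_symmetric.
  by case: u.
move=> u i j v su; rewrite fE [RHS]fE sA; congr (_ - _).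
exact: (conv_symmetric_lt mcm_pos_killed IH spos).
Qed.

(* The invariant vector field of b: its Maurer-Cartan value is the conjugate of b. *)
Definition vfield (b : B) : seq J -> B :=
  xget (fun=> 0) [set f | contract f mcm =1 adflow lt e b].

Lemma vfieldE b : contract (vfield b) mcm =1 adflow lt e b.
Proof.
rewrite /vfield; case: xgetP => [f _ //|none].
by have [f fE] := contract_mcm_onto (adflow lt e b); case: (none f).
Qed.

Lemma vfield_uniq b f : contract f mcm =1 adflow lt e b -> f =1 vfield b.
Proof. by move=> fE; apply: contract_mcm_inj => w; rewrite fE vfieldE. Qed.

Lemma vfield_linear w : linear (fun b => vfield b w).
Proof.
move=> c b b'; apply/esym.
apply: (@vfield_uniq _ (fun w => c *: vfield b w + vfield b' w)) => u.
rewrite /contract conv_linear_l; last by move=> psi d x y; rewrite linearP.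
rewrite -/(contract _ _) -/(contract _ _) !vfieldE.
by rewrite /adflow (@flow_linear _ _ _ (adPair B)).
Qed.

Lemma vfield_symmetric b : symmetric_word (vfield b).
Proof.
apply: contract_mcm_symmetric => u i j v; rewrite !vfieldE.
exact: (@flow_symmetric _ _ _ lt_irr lt_trans lt_total (adPair B)).
Qed.

Definition vact (V : lmodType K) (b : B) (phi : seq J -> V) : seq J -> V :=
  contract (vfield b) (grad phi).

Lemma vact_contract (V : lmodType K) b f (Phi : seq J -> J -> V) w :
  vact b (contract f Phi) w = contract (vact b f) Phi w
    + contract f (fun u i => vact b (Phi^~ i) u) w.
Proof.
have -> : vact b (contract f Phi) w =
    contract (vfield b) (fun u j => contract (fun v => f (j :: v)) Phi u) w
    + contract (vfield b) (fun u j => contract f (fun v => Phi (j :: v)) u) w.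
  rewrite /vact -convDr; last by move=> v; apply: linear_morphD; apply: ext_linear.
  apply: eq_conv => // u _; apply/funext => j.
  by rewrite /grad /contract conv_cons.
rewrite (contract_conv_l _ (grad f)); last by move=> t c x y; rewrite linearP.
congr (_ + _).
by rewrite (contract_swap (vfield b) f (fun u j i => Phi (j :: u) i)).
Qed.

(** The derivative of [g^-1 b' g] is its bracket with the Maurer-Cartan form, whose value on the
    field of [b] is [g^-1 b g]. *)
Lemma vact_adflow b b' w :
  vact b (adflow lt e b') w = adflow lt e (lie b' b) w.
Proof.
rewrite /adflow (@flow_act _ _ _ (adPair B)) -/(adflow lt e b') /=.
rewrite -(@eq_conv J _ _ _ lie (adflow lt e b') _ (contract (vfield b) mcm));
  [|by []|by move=> u _; rewrite vfieldE].
rewrite -contract_conv_r //; last by move=> t; apply: lie_linearr.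
apply: eq_conv => // u _; apply/funext => j; rewrite /grad /adflow.
exact: (@flowS _ _ lt (adPair B)).
Qed.

(** A vector field is determined by its Maurer-Cartan value, so both sides are compared after
    contraction with the form, as in Cartan's formula for [d theta]. *)
Lemma vact_vfield b b' w :
  vact b' (vfield b) w - vact b (vfield b') w = vfield (lie b b') w.
Proof.
move: w; apply: vfield_uniq => w.
have -> : contract (fun u => vact b' (vfield b) u - vact b (vfield b') u) mcm w =
    contract (vact b' (vfield b)) mcm w - contract (vact b (vfield b')) mcm w.
  have /= := conv_linear_l (-1) (vact b (vfield b')) (vact b' (vfield b)) mcm w
    (mu := fun v psi => ext psi v) (fun psi d x y => linearP _ _ _ _).
  rewrite /contract scaleN1r addrC => <-; apply: eq_conv => // u _.
  by rewrite scaleN1r addrC.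
have key c c' : contract (vact c' (vfield c)) mcm w =
    adflow lt e (lie c c') w - contract (vfield c) (fun u i =>
      contract (vfield c') (fun v j => mc_form lt e i (j :: v)) u) w.
  rewrite -vact_adflow.
  by rewrite -(funext (vfieldE c)) vact_contract addrK.
rewrite !key (contract_swap (vfield b') (vfield b)
  (fun v i j => mc_form lt e i (j :: v))).
set F1 := contract (vfield b) _ w; set F2 := contract (vfield b) _ w.
(* This difference is [d theta] on the two fields; by flatness it is the bracket of the two
   conjugates. It removes one of the two copies of the conjugate of [lie b b'] supplied by [key]. *)
have F12 : F1 - F2 = adflow lt e (lie b b') w.
  rewrite /adflow (@flow_act _ _ _ (adPair B)) -/(adflow lt e b) -/(adflow lt e b').
  rewrite /= -(funext (vfieldE b)) -(funext (vfieldE b')).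
  rewrite -contract_conv_l; last by move=> t; apply: lie_linearl.
  rewrite -contractB; apply: eq_conv => // u _; apply/funext => i.
  rewrite -contract_conv_r; last by move=> t; apply: lie_linearr.
  rewrite fctE -contractB; apply: eq_conv => // v _; apply/funext => j.
  exact: mc_form_flat.
have -> : adflow lt e (lie b' b) w = - adflow lt e (lie b b') w.
  rewrite (lieC b' b).
  exact: (linear_morphN (@flow_linear _ _ lt (adPair B) e w) (lie b b')).
by rewrite opprD !opprK addrACA [- F1 + F2]addrC -opprB F12 addrK.
Qed.

(** The second derivatives of [phi] cancel by symmetry, and [vact_vfield] gives the first-order
    terms. *)
Lemma vact_lie (V : lmodType K) b b' (phi : seq J -> V) w : symmetric_word phi ->
  vact (lie b b') phi w = vact b' (vact b phi) w - vact b (vact b' phi) w.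
Proof.
move=> sphi; rewrite !vact_contract -/(contract _ _).
set X1 := contract (vact b' (vfield b)) _ w.
set X2 := contract (vact b (vfield b')) _ w.
have -> : vact (lie b b') phi w = X1 - X2.
  rewrite /vact -/(vfield _) -(funext (vact_vfield b b')).
  have /= := conv_linear_l (-1) (vact b (vfield b')) (vact b' (vfield b)) (grad phi) w
    (mu := fun v psi => ext psi v) (fun psi d x y => linearP _ _ _ _).
  rewrite scaleN1r addrC => <-; apply: eq_conv => // u _.
  by rewrite scaleN1r addrC.
have -> : contract (vfield b) (fun u i => vact b' (grad phi ^~ i) u) w =
    contract (vfield b') (fun u i => vact b (grad phi ^~ i) u) w.
  rewrite /vact (contract_swap _ _ (fun v i j => grad phi (j :: v) i)).
  apply: eq_conv => // u _; apply/funext => i; apply: eq_conv => // v _.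
  by apply/funext => j; apply: (sphi [::]).
by rewrite opprD addrACA subrr addr0.
Qed.

Lemma vact_symmetric (V : lmodType K) b (phi : seq J -> V) :
  symmetric_word phi -> symmetric_word (vact b phi).
Proof.
by move=> s; apply: contract_symmetric (vfield_symmetric b) (grad_symmetric s).
Qed.

Lemma vact_linear_l (V : lmodType K) (phi : seq J -> V) w :
  linear (fun b => vact b phi w).
Proof.
move=> c b b'; rewrite /vact /contract -conv_linear_l; last first.
  by move=> psi d x y; rewrite linearP.
by apply: eq_conv => // u _; rewrite vfield_linear.
Qed.

Lemma vact_linear_r (V : lmodType K) b c (phi psi : seq J -> V) w :
  vact b (fun u => c *: phi u + psi u) w = c *: vact b phi w + vact b psi w.
Proof. by rewrite /vact /contract -conv_linear_r //; apply: ext_linear. Qed.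

Lemma vact_conv (U V W : lmodType K) (mu : U -> V -> W) b f g w :
    (forall v, linear (mu^~ v)) -> (forall u, linear (mu u)) ->
  vact b (conv mu f g) w = conv mu (vact b f) g w + conv mu f (vact b g) w.
Proof.
move=> mull mulr; rewrite /vact -contract_conv_l // -contract_conv_r //.
rewrite -convDr; last by move=> v; apply: linear_morphD; apply: ext_linear.
apply: eq_conv => // u _; apply/funext => j.
by rewrite /grad conv_cons.
Qed.

End VectorFields.

(** * Action polynomials and their derivatives *)

Section ActionPolynomials.
Variables (K : fieldType) (I : choiceType).

Definition mon (s : seq I) : freeAssoc K I := << FMonom s >>.

Definition act_word (P : liePair K) (w : pmod P) (a : I -> palg P) (s : seq I) :
    pmod P :=
  foldl (@pact K P) w [seq a i | i <- s].

(** For the alphabet [nat] this is convertible to [act_value]; other alphabets serve to evaluate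
    elements of the free associative algebra on [I]. *)
Definition act_eval (P : liePair K) (w : pmod P) (a : I -> palg P) :
    freeAssoc K I -> pmod P :=
  linext (fun m : {fmonom I} => act_word w a (fmonom_val m)).

HB.instance Definition _ (P : liePair K) (w : pmod P) (a : I -> palg P) :=
  GRing.isLinear.Build K (freeAssoc K I) (pmod P) *:%R (act_eval w a)
    (linext_is_linear _).

Lemma act_evalD (P : liePair K) (w : pmod P) a f g :
  act_eval w a (f + g) = act_eval w a f + act_eval w a g.
Proof. exact: linearD. Qed.

Lemma act_evalB (P : liePair K) (w : pmod P) a f g :
  act_eval w a (f - g) = act_eval w a f - act_eval w a g.
Proof. exact: linearB. Qed.

Lemma act_evalZ (P : liePair K) (w : pmod P) a c f :
  act_eval w a (c *: f) = c *: act_eval w a f.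
Proof. exact: linearZ. Qed.

Lemma act_eval0 (P : liePair K) (w : pmod P) a : act_eval w a 0 = 0.
Proof. exact: linear0. Qed.

Lemma act_eval_mon (P : liePair K) (w : pmod P) a s :
  act_eval w a (mon s) = act_word w a s.
Proof. by rewrite /act_eval linextU. Qed.

Lemma act_word_hom (P Q : liePair K) (h : pairHom P Q) w a s :
  hmod h (act_word w a s) = act_word (hmod h w) (halg h \o a) s.
Proof. by elim: s w => //= i s IH w; rewrite /act_word /= IH hact. Qed.

Lemma act_eval_hom (P Q : liePair K) (h : pairHom P Q) w a f :
  hmod h (act_eval w a f) = act_eval (hmod h w) (halg h \o a) f.
Proof.
rewrite /act_eval linext_comp; apply: eq_linext => m _ /=.
exact: act_word_hom.
Qed.

End ActionPolynomials.

Section PairMaps.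
Variable K : fieldType.

Definition idHom (A : lieAlgType K) : lieHom A A :=
  @LieHom K A A idfun (fun a b => erefl).

Fact subLie_val_linear (A : lieAlgType K) (H : lieSub A) :
  linear (fun a : subLie H => sval a).
Proof. by []. Qed.

Definition subLie_incl (A : lieAlgType K) (H : lieSub A) : lieHom (subLie H) A :=
  @LieHom K (subLie H) A (HB.pack (fun a : subLie H => sval a)
    (GRing.isLinear.Build K (subLie H) A *:%R _ (@subLie_val_linear A H)))
    (fun a b => erefl).

Definition restr_incl (P : liePair K) (H : lieSub (palg P)) :
    pairHom (restrPair H) P :=
  @PairHom K (restrPair H) P idfun (subLie_incl H) (fun w a => erefl).

Fact submod_val_linear (P : liePair K) (W : submodule P) :
  linear (fun w : pmod (submodPair W) => sval w).
Proof. by []. Qed.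

Definition submod_incl (P : liePair K) (W : submodule P) :
    pairHom (submodPair W) P :=
  @PairHom K (submodPair W) P (HB.pack (fun w : pmod (submodPair W) => sval w)
    (GRing.isLinear.Build K (pmod (submodPair W)) (pmod P) *:%R _
       (@submod_val_linear P W)))
    (idHom (palg P)) (fun w a => erefl).

Definition quot_proj (P : liePair K) (W : submodule P) : pairHom P (quotPair W) :=
  @PairHom K P (quotPair W) (Defs.projv W) (idHom (palg P)) (@projv_act K P W).

Definition quotLie_proj (A : lieAlgType K) (H : lieIdeal A) : lieHom A (quotLie H) :=
  @LieHom K A (quotLie H) (projLie H) (@projLie_lie K A H).

End PairMaps.

(** * Derivatives of identities, and identities under convolution *)

Section Derivative.
Variable K : fieldType.

(* In the words below the letters 2i and 2i+1 are two copies of the letter i. *)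
Fixpoint duplications (m : seq nat) : seq (seq nat) :=
  if m is i :: m' then
    [seq i.*2 :: s | s <- duplications m'] ++ [seq i.*2.+1 :: s | s <- duplications m']
  else [:: [::]].

Fixpoint derivations (m : seq nat) : seq (seq nat) :=
  if m is i :: m' then
    (i.*2.+1 :: [seq k.*2 | k <- m']) :: [seq i.*2 :: s | s <- derivations m']
  else [::].

Lemma duplications_even (V : zmodType) (F : seq nat -> V) m :
  \sum_(s <- duplications m) (if count odd s == 0%N then F s else 0) =
  F [seq k.*2 | k <- m].
Proof.
elim: m F => [|i m IH] F; first by rewrite big_seq1.
rewrite /= big_cat !big_map /= odd_double.
by rewrite [X in _ + X]big1 ?addr0 ?(IH (fun s => F (i.*2 :: s))).
Qed.

Lemma duplications_linear (V : zmodType) (F : seq nat -> V) m :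
  \sum_(s <- duplications m) (if count odd s == 1%N then F s else 0) =
  \sum_(s <- derivations m) F s.
Proof.
elim: m F => [|i m IH] F; first by rewrite big_seq1 big_nil.
rewrite /= big_cat !big_map big_cons big_map /= odd_double /= addrC.
congr (_ + _); last exact: (IH (fun s => F (i.*2 :: s))).
exact: (duplications_even (fun s => F (i.*2.+1 :: s))).
Qed.

Lemma act_word_duplications (P : liePair K) w (a : nat -> palg P) m :
  \sum_(s <- duplications m) act_word w a s =
  act_word w (fun i => a i.*2 + a i.*2.+1) m.
Proof.
elim: m w => [|i m IH] w; first by rewrite big_seq1.
rewrite /= big_cat !big_map /act_word /= -/(act_word _ _ m).
have actD u u' s : act_word (u + u') a s = act_word u a s + act_word u' a s.
  by elim: s u u' => //= k s IHs u u'; rewrite /act_word /= -IHs -pactDl.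
rewrite pactDr -!IH -!big_split /=; apply: eq_bigr => s _.
by rewrite -actD.
Qed.

Variables (X : repClass K) (hX : multihomogeneous X).

(** A condition stable under permutation of letters depends on the multidegree only, so it selects a
    sum of multihomogeneous components, each an identity. *)
Lemma identity_part (v : freeAssoc K nat) (Q : pred (seq nat)) (P : liePair K)
    (w : pmod P) a : rep_identity X v -> X P ->
    (forall s t, perm_eq s t -> Q s = Q t) ->
  linext (fun m : {fmonom nat} =>
    if Q (fmonom_val m) then act_word w a (fmonom_val m) else 0) v = 0.
Proof.
move=> vX XP Qperm; rewrite /linext.
(* The sorted word encodes the multidegree. *)
pose c (m : {fmonom nat}) := sort leq (fmonom_val m).
pose r := undup [seq c m | m <- msupp v].
pose T m := v@_m *: (if Q (fmonom_val m) then act_word w a (fmonom_val m) else 0).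
rewrite (eq_big_seq (fun m => \sum_(k <- r | k == c m) T m)); last first.
  move=> m vm; rewrite big_mkcond (bigD1_seq (c m)) ?undup_uniq //=; last first.
    by rewrite mem_undup map_f.
  by rewrite eqxx big1 ?addr0 // => k /negPf ->.
rewrite (exchange_big_dep predT) //= big1_seq // => k /=.
rewrite mem_undup => /mapP[m0 _ ->].
have cE m : (c m0 == c m) =
    `[< forall i, count_mem i (fmonom_val m) = count_mem i (fmonom_val m0) >].
  apply/eqP/asboolP => [/esym e i|e].
    by apply/permP/(perm_sortP leq_total leq_trans anti_leq).
  apply/(perm_sortP leq_total leq_trans anti_leq).
  by apply/allP => i _ /=; rewrite e.
have [Qm0|nQm0] := boolP (Q (fmonom_val m0)); last first.
  rewrite big1 // => m /eqP/(perm_sortP leq_total leq_trans anti_leq) pm.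
  by rewrite /T -(Qperm _ _ pm) (negPf nQm0) scaler0.
have := hX vX (fun i => count_mem i (fmonom_val m0)) XP w a.
rewrite -[act_value _ _ _]/(act_eval w a _) /mh_component linear_sum => z0.
rewrite -[RHS]z0.
apply: eq_big => [m|m]; first exact: cE.
move=> /eqP/(perm_sortP leq_total leq_trans anti_leq) pm.
rewrite linearZ /= /T -(Qperm _ _ pm) Qm0; congr (_ *: _).
by rewrite /act_eval linextU.
Qed.

Definition derivative (v : freeAssoc K nat) : freeAssoc K nat :=
  linext (fun m : {fmonom nat} =>
    \sum_(s <- derivations (fmonom_val m)) mon K s) v.

Lemma linext_derivative (V : lmodType K) (F : seq nat -> V) v :
  linext (fun m : {fmonom nat} => F (fmonom_val m)) (derivative v) =
  linext (fun m : {fmonom nat} => \sum_(s <- derivations (fmonom_val m)) F s) v.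
Proof.
rewrite linext_comp; apply: eq_linext => m _ /=.
by rewrite linear_sum; apply: eq_bigr => s _; rewrite /= linextU.
Qed.

(** Substituting [x_i + z_i] for [x_i] and keeping the part of degree 1 in the
    [z_i] is possible inside a multihomogeneous variety. *)
Lemma derivative_identity v : rep_identity X v -> rep_identity X (derivative v).
Proof.
move=> vX; pose v2 : freeAssoc K nat := linext (fun m : {fmonom nat} =>
  \sum_(s <- duplications (fmonom_val m)) mon K s) v.
have v2E (V : lmodType K) (F : seq nat -> V) :
    linext (fun m : {fmonom nat} => F (fmonom_val m)) v2 =
    linext (fun m : {fmonom nat} => \sum_(s <- duplications (fmonom_val m)) F s) v.
  rewrite linext_comp; apply: eq_linext => m _ /=.
  by rewrite linear_sum; apply: eq_bigr => s _; rewrite /= linextU.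
have v2X : rep_identity X v2.
  move=> P XP w a; rewrite -[LHS]/(act_eval w a v2) /act_eval v2E.
  rewrite -[RHS](vX P XP w (fun i => a i.*2 + a i.*2.+1)).
  by apply: eq_linext => m _; rewrite /= act_word_duplications.
move=> P XP w a; rewrite -[LHS]/(act_eval w a _) /act_eval linext_derivative.
have Qperm s t : perm_eq s t -> (count odd s == 1%N) = (count odd t == 1%N).
  by move/permP => ->.
rewrite -[RHS](identity_part w a v2X XP Qperm).
rewrite (v2E _ (fun s => if count odd s == 1%N then act_word w a s else 0)).
by apply: eq_linext => m _; rewrite duplications_linear.
Qed.

Section ConvolutionIdentities.
Variables (J : Type) (P : liePair K).

Definition conv_word (phi : seq J -> pmod P) (eta : nat -> seq J -> palg P)
    (m : seq nat) : seq J -> pmod P :=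
  foldl (fun f g => conv (@pact K P) f g) phi [seq eta i | i <- m].

Lemma conv_word_nil phi eta m :
  conv_word phi eta m [::] = act_word (phi [::]) (fun i => eta i [::]) m.
Proof.
elim: m phi => //= i m IH phi.
by rewrite -[LHS]/(conv_word (conv _ phi (eta i)) eta m [::]) IH conv_nil.
Qed.

Lemma conv_wordD phi phi' eta m :
  conv_word (fun u => phi u + phi' u) eta m =
  (fun u => conv_word phi eta m u + conv_word phi' eta m u).
Proof.
elim: m phi phi' => //= i m IH phi phi'; rewrite /conv_word /= -IH.
congr (foldl _ _ _); apply/funext => u.
by rewrite convDl //; apply: pactDl.
Qed.

(** The Leibniz rule: [j] falls on [phi] or on one factor [eta i]. The odd copy of a letter marks
    the factor that [eta'] differentiates. *)
Lemma shift_conv_word j phi eta m w :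
  let eta' i := if odd i then shift j (eta i./2) else eta i./2 in
  conv_word phi eta m (j :: w) = conv_word (shift j phi) eta m w
    + \sum_(s <- derivations m) conv_word phi eta' s w.
Proof.
move=> eta'; elim: m phi => [|i m IH] phi; first by rewrite big_nil addr0.
have dblE f : conv_word f eta' [seq k.*2 | k <- m] = conv_word f eta m.
  rewrite /conv_word -map_comp; congr (foldl _ _ _); apply: eq_map => k /=.
  by rewrite /eta' odd_double doubleK.
rewrite -[LHS]/(conv_word (conv _ phi (eta i)) eta m (j :: w)) IH.
rewrite big_cons big_map.
rewrite shift_conv conv_wordD -addrA; congr (_ + (_ + _)).
  by rewrite -dblE /conv_word /= /eta' /= odd_double uphalf_double.
by apply: eq_bigr => s _; rewrite /conv_word /= /eta' odd_double doubleK.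
Qed.

(** At the empty word the value is computed in the pair restricted to [H]. Differentiating along [j]
    yields the value of [v] at the shifted [phi] plus a value of [derivative v], so the induction
    must range over all identities and families. *)
Lemma conv_identity (H : lieSub (palg P)) v w phi eta :
    X (restrPair H) -> rep_identity X v -> (forall i u, eta i u \in H) ->
  linext (fun m : {fmonom nat} => conv_word phi eta (fmonom_val m) w) v = 0.
Proof.
move=> XH; elim: w v phi eta => [|j w IH] v phi eta vX etaH.
  pose c i : subLie H := exist (fun a => a \in ssp H) _ (etaH i [::]).
  rewrite -[RHS](vX _ XH (phi [::]) c); apply: eq_linext => m _.
  rewrite conv_word_nil; exact/esym/(act_word_hom (restr_incl H) _ c).
rewrite (_ : linext _ _ = linext (fun m : {fmonom nat} =>
    conv_word (shift j phi) eta (fmonom_val m) w) v +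
  linext (fun m : {fmonom nat} => \sum_(s <- derivations (fmonom_val m))
    conv_word phi (fun i => if odd i then shift j (eta i./2) else eta i./2) s w) v).
  rewrite IH // add0r -(@linext_derivative _ (fun s => conv_word _ _ s w)) IH //.
    exact: derivative_identity.
  by move=> i u; case: ifP => _; apply: etaH.
rewrite -big_split; apply: eq_bigr => m _ /=.
by rewrite shift_conv_word scalerDr.
Qed.

End ConvolutionIdentities.
End Derivative.

(** * Operators on symmetric functions *)

Section GeneralLinear.
Variables (K : fieldType) (V : lmodType K).

Definition endo_pred : {pred V -> V} := fun f => `[< linear f >].

Fact endo_closed : submod_closed endo_pred.
Proof.
split; first by apply/asboolP => c u v; rewrite scaler0 addr0.
move=> c f g /asboolP fl /asboolP gl; apply/asboolP => d u v.
by rewrite !fctE fl gl !scalerDr addrACA !scalerA mulrC.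
Qed.

Definition gl : Type := subv (Subspace endo_closed).
HB.instance Definition _ := SubType.on gl.
HB.instance Definition _ := GRing.Lmodule.on gl.

Definition glact (w : V) (f : gl) : V := sval f w.

Lemma glact_linearl f : linear (fun w => glact w f).
Proof. by have /asboolP := svalP f. Qed.

Lemma gl_eq (f g : gl) : (forall w, glact w f = glact w g) -> f = g.
Proof. by move=> e; apply: val_inj; apply/funext => w; apply: e. Qed.

Definition mkgl (f : V -> V) (fl : linear f) : gl := exist _ f (asboolT fl).

Lemma glact_linearr w : linear (glact w).
Proof. by []. Qed.

Fact gl_lie_linear (f g : gl) :
  linear (fun w => glact (glact w f) g - glact (glact w g) f).
Proof.
by move=> c u v; rewrite !glact_linearl scalerBr opprD addrACA.
Qed.

(** Endomorphisms act on the right: [f] is applied first in the first term. *)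
Definition gl_lie (f g : gl) : gl := mkgl (gl_lie_linear f g).

Lemma gl_lieE f g w :
  glact w (gl_lie f g) = glact (glact w f) g - glact (glact w g) f.
Proof. by []. Qed.

Fact gl_lie_linearl g : linear (fun f => gl_lie f g).
Proof.
move=> c f f'; apply: gl_eq => w; rewrite glact_linearr.
rewrite !gl_lieE !glact_linearr glact_linearl.
by rewrite scalerBr opprD addrACA.
Qed.
Fact gl_lie_linearr f : linear (gl_lie f).
Proof.
move=> c g g'; apply: gl_eq => w; rewrite glact_linearr.
rewrite !gl_lieE !glact_linearr glact_linearl.
by rewrite scalerBr opprD addrACA.
Qed.
Fact gl_liexx f : gl_lie f f = 0.
Proof. by apply: gl_eq => w; apply: subrr. Qed.
Fact gl_lie_jacobi f g h :
  gl_lie f (gl_lie g h) + gl_lie g (gl_lie h f) + gl_lie h (gl_lie f g) = 0.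
Proof.
apply: gl_eq => w.
have D (f' g' : gl) : glact w (f' + g') = glact w f' + glact w g' by [].
rewrite !D !gl_lieE.
rewrite !(linear_morphB (glact_linearl _)) !opprB !addrA.
rewrite [LHS](ACl ((1*12)*(7*2)*(3*10)*(5*4)*(9*8)*(11*6)))%AC /=.
by rewrite !subrr !addr0.
Qed.
HB.instance Definition _ := Lmodule_isLie.Build K gl
  gl_lie_linearl gl_lie_linearr gl_liexx gl_lie_jacobi.

Definition glPair : liePair K :=
  @LiePair K V gl glact glact_linearl glact_linearr
    (fun w f g => erefl (glact (glact w f) g - glact (glact w g) f)).

End GeneralLinear.

Section SymmetricFunctions.
Variables (K : fieldType) (J : Type) (V : lmodType K).

Definition symmetric_pred : {pred seq J -> V} := fun f => `[< symmetric_word f >].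

Fact symmetric_closed : submod_closed symmetric_pred.
Proof.
split; first by apply/asboolP.
move=> c f g /asboolP sf /asboolP sg; apply/asboolP => u i j v.
by rewrite !fctE sf sg.
Qed.

(** Series in commuting coordinates; on these the invariant fields act as a Lie algebra, by
    [vact_lie]. *)
Definition symfun : Type := subv (Subspace symmetric_closed).
HB.instance Definition _ := SubType.on symfun.
HB.instance Definition _ := GRing.Lmodule.on symfun.

Definition sf_val (f : symfun) : seq J -> V := sval f.
Definition mksf (f : seq J -> V) (sf : symmetric_word f) : symfun :=
  exist (fun f => f \in symmetric_pred) f (asboolT sf).

Lemma sf_symmetric (f : symfun) : symmetric_word (sf_val f).
Proof. exact: asboolW (svalP f). Qed.

Lemma sf_eq (f g : symfun) : sf_val f =1 sf_val g -> f = g.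
Proof. by move=> e; apply: val_inj; apply/funext => w; apply: e. Qed.

Lemma sf_val_linear w : linear (fun f => sf_val f w).
Proof. by []. Qed.

End SymmetricFunctions.

(** * Splitting the action into a base part and invariant fields *)

Section GaugeEmbedding.
Variables (K : fieldType) (P : liePair K) (H : lieIdeal (palg P)).
Let B : lieAlgType K := quotLie H.
Variables (J : choiceType) (lt : rel J).
Hypotheses (lt_irr : irreflexive lt) (lt_trans : transitive lt).
Hypothesis lt_total : forall i j, i != j -> lt i j || lt j i.
Variables (e : J -> B).
Variable ext : forall V : lmodType K, (J -> V) -> {linear B -> V}.
Hypothesis extE : forall (V : lmodType K) (psi : J -> V) j, ext psi (e j) = psi j.
Hypothesis ext_eq : forall (V : lmodType K) (h h' : {linear B -> V}),
  (forall j, h (e j) = h' (e j)) -> h =1 h'.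

Let p : lieHom (palg P) B := quotLie_proj H.
Let a (j : J) : palg P := repr (e j).

Let pa : p \o a = e.
Proof. by apply/funext => j; apply: projLie_repr. Qed.

Let field := vfield lt e ext.
Let act (V : lmodType K) := @vact K J lt B e ext V.

(** With [g] the product of the exponentials of the lifts [a j], this is [g^-1 x g] minus the
    logarithmic derivative of [g] along the field of [p x]: the part of [x] left over by the action
    of the quotient. *)
Definition gauge (x : palg P) : seq J -> palg P := fun w =>
  adflow lt a x w - contract ext (field (p x)) (fun u j => mc_form lt a j u) w.

Lemma ker_p x : p x = 0 -> x \in H.
Proof.
move=> px; have : Defs.projv H x == Defs.projv H 0 by rewrite linear0; apply/eqP.
by rewrite projv_eq subr0.
Qed.

Lemma p_ker x : x \in H -> p x = 0.
Proof.
move=> xH; have /eqP : Defs.projv H x == Defs.projv H 0 by rewrite projv_eq subr0.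
by rewrite linear0.
Qed.

Lemma p_contract f w :
  p (contract ext f (fun u j => mc_form lt a j u) w) = contract ext f (mcm lt e) w.
Proof.
rewrite /contract conv_comp; last by move=> x y; rewrite linearD.
apply: eq_bigr => q _; rewrite (ext_comp extE ext_eq _ _ (linearP p)).
congr (ext _ _); apply/funext => j.
by rewrite (mc_form_hom lt p) pa.
Qed.

(** The map [p] carries the forms of the lifts to those of [e], where the defining property of
    [vfield] makes the two terms equal. *)
Lemma gauge_ker x w : gauge x w \in H.
Proof.
apply: ker_p; rewrite linearB p_contract (vfieldE lt extE ext_eq).
by rewrite (flow_hom lt (adHom p)) /= pa subrr.
Qed.

Lemma gauge_symmetric x : symmetric_word (gauge x).
Proof.
move=> u i j v; rewrite /gauge; congr (_ - _).
  exact: (@flow_symmetric _ _ _ lt_irr lt_trans lt_total (adPair (palg P))).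
apply: contract_symmetric => [|u' i' j' v'].
  exact: (vfield_symmetric lt_irr lt_trans lt_total extE ext_eq).
by apply/funext => k; apply: (mc_form_symmetric lt_irr lt_trans lt_total).
Qed.

(** In [(m x) g = (m g) (g^-1 x g)], the logarithmic derivative contained in [g^-1 x g]
    differentiates [m g] along the field of [p x]. *)
Lemma flow_gauge m x w : flow lt a (pact m x) w =
  conv (@pact K P) (flow lt a m) (gauge x) w + act (p x) (flow lt a m) w.
Proof.
have -> : act (p x) (flow lt a m) w =
    conv (@pact K P) (flow lt a m)
      (contract ext (field (p x)) (fun u j => mc_form lt a j u)) w.
  rewrite -(contract_conv_r extE ext_eq); last by move=> t; apply: pact_linearr.
  by apply: eq_conv => // u _; apply/funext => j; rewrite /grad flowS.
rewrite -convDr; last exact: pactDr.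
by rewrite flow_act; apply: eq_conv => // u _; rewrite subrK.
Qed.

Let G : lmodType K := symfun J (pmod P).

Definition gauge_iota (m : pmod P) : G :=
  mksf (@flow_symmetric _ _ _ lt_irr lt_trans lt_total P a m).

Lemma gauge_iota_linear : linear gauge_iota.
Proof. by move=> c m m'; apply: sf_eq => w; apply: flow_linear. Qed.

Let act_symmetric b (f : G) : symmetric_word (act b (sf_val f)).
Proof.
exact: (vact_symmetric lt_irr lt_trans lt_total extE ext_eq b (sf_symmetric f)).
Qed.

Lemma top_act_linear b : linear (fun f : G => mksf (act_symmetric b f)).
Proof.
by move=> c f g; apply: sf_eq => w; apply: (vact_linear_r lt extE ext_eq).
Qed.

Definition top_act (b : B) : gl G := mkgl (top_act_linear b).

Fact top_act_is_linear : linear top_act.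
Proof.
move=> c b b'; apply: gl_eq => f; apply: sf_eq => w.
exact: (vact_linear_l lt extE ext_eq).
Qed.

Fact top_act_lie b b' : top_act (lie b b') = lie (top_act b) (top_act b').
Proof.
apply: gl_eq => f; apply: sf_eq => w.
exact: (vact_lie lt_irr lt_trans lt_total extE ext_eq _ _ _ (sf_symmetric f)).
Qed.

Definition top_hom : lieHom B (gl G) :=
  @LieHom K B (gl G) (HB.pack top_act
    (GRing.isLinear.Build K B (gl G) *:%R top_act top_act_is_linear)) top_act_lie.

Let conv_symm (f : G) (eta : symfun J (palg P)) :
  symmetric_word (conv (@pact K P) (sf_val f) (sf_val eta)).
Proof. exact: conv_symmetric (sf_symmetric f) (sf_symmetric eta). Qed.

Fact base_act_linear eta : linear (fun f : G => mksf (conv_symm f eta)).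
Proof.
by move=> c f g; apply: sf_eq => w; apply: conv_linear_l; apply: pact_linearl.
Qed.

Definition base_act (eta : symfun J (palg P)) : gl G := mkgl (base_act_linear eta).

Lemma base_actE eta f w :
  sf_val (glact f (base_act eta)) w = conv (@pact K P) (sf_val f) (sf_val eta) w.
Proof. by []. Qed.

Definition base_pred : {pred gl G} := fun c =>
  `[< exists2 eta, (forall w, sf_val eta w \in H) & c = base_act eta >].

Fact base_closed : submod_closed base_pred.
Proof.
split.
  apply/asboolP; exists 0 => [w|]; first exact: rpred0.
  apply: gl_eq => f; apply: sf_eq => w; rewrite base_actE /conv big1 // => q _.
  exact: (linear_morph0 (pact_linearr _)).
move=> c f g /asboolP[eta etaH ->] /asboolP[zeta zetaH ->]; apply/asboolP.
exists (c *: eta + zeta) => [w|].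
  by rewrite sf_val_linear rpredD ?rpredZ.
apply: gl_eq => phi; apply: sf_eq => w.
by apply/esym/conv_linear_r/pact_linearr.
Qed.

Definition base_space : subspace (gl G) := Subspace base_closed.

Lemma base_lie : {in base_space &, forall c d, lie c d \in base_space}.
Proof.
move=> _ _ /asboolP[eta etaH ->] /asboolP[zeta zetaH ->]; apply/asboolP.
exists (mksf (conv_symmetric lie (sf_symmetric eta) (sf_symmetric zeta))).
  move=> w; apply: rpred_sum => q _; apply: (lideal_lie (l := H)); exact: etaH.
by apply: gl_eq => f; apply: sf_eq => w; apply/esym/conv_pact_lie.
Qed.

(** Fields are derivations of convolution, so the commutator is convolution by the derivative of the
    kernel [eta]. *)
Lemma base_top_lie c b : c \in base_space -> lie c (top_hom b) \in base_space.
Proof.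
move=> /asboolP[eta etaH ->]; apply/asboolP.
exists (mksf (vact_symmetric lt_irr lt_trans lt_total extE ext_eq b (sf_symmetric eta))).
  (* Membership in [H] is tested by [p], which commutes with [ext] and kills the values of [eta]. *)
  move=> w; apply: rpred_sum => q _; apply: ker_p.
  rewrite (ext_comp extE ext_eq _ _ (linearP p)).
  rewrite (_ : (fun j => _) = 0); first exact: (linear_morph0 (ext_linear extE ext_eq _)).
  by apply/funext => j; apply: p_ker; apply: etaH.
apply: gl_eq => f; apply: sf_eq => w; rewrite base_actE.
rewrite [LHS]/(act b (conv (@pact K P) (sf_val f) (sf_val eta)) w
  - conv (@pact K P) (act b (sf_val f)) (sf_val eta) w).
rewrite /act (vact_conv lt extE ext_eq b _ _ w (@pact_linearl K P) (@pact_linearr K P)).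
have xyx (x y : pmod P) : x + y - x = y by rewrite addrAC subrr add0r.
exact: xyx.
Qed.

Lemma base_identity (X : repClass K) v (f : G) (c : nat -> gl G) :
    multihomogeneous X -> X (restrPair H) -> rep_identity X v ->
    (forall i, c i \in base_space) ->
  act_value (P := glPair G) f c v = 0.
Proof.
move=> hX XH vX /(_ _)/asboolW/cid2 cC.
pose eta i := s2val (cC i); have cE i : c i = base_act (eta i) := s2valP' (cC i).
have etaH i w : sf_val (eta i) w \in H := s2valP (cC i) w.
apply: sf_eq => w.
rewrite -[RHS](conv_identity hX w (sf_val f) XH vX etaH).
rewrite -[act_value _ _ _]/(act_eval (P := glPair G) f c v).
have hl : linear (fun f : G => sf_val f w) by [].
pose h : {linear G -> pmod P} := HB.pack (fun f : G => sf_val f w)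
  (GRing.isLinear.Build K G (pmod P) *:%R _ hl).
rewrite -[LHS]/(h _) /act_eval linext_comp; apply: eq_linext => m _ /=.
elim: (fmonom_val m) f => //= i s IH f.
by rewrite /act_word /= IH cE; congr (foldl _ _ _ w).
Qed.

End GaugeEmbedding.

(** A formal analogue, in all characteristics, of the Kaloujnine-Krasner
    embedding: [P] sits in an induced pair on which [L = palg P] acts through
    the sum of a base part [omega] and of an action [psi] of [L / H]. *)
Lemma gauge_embedding (K : fieldType) (P : liePair K) (H : lieIdeal (palg P)) :
  exists (G : lmodType K) (iota : {linear pmod P -> G}) (omega : palg P -> gl G)
      (psi : lieHom (quotLie H) (gl G)) (C : subspace (gl G)),
  [/\ injective iota,
      forall m x, iota (pact m x) =
        glact (iota m) (omega x) + glact (iota m) (psi (projLie H x)),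
      forall x, omega x \in C,
      {in C &, forall c d, lie c d \in C} /\
        (forall c b, c \in C -> lie c (psi b) \in C)
    & forall X v f (c : nat -> gl G), multihomogeneous X -> X (restrPair H) ->
        rep_identity X v -> (forall i, c i \in C) ->
        act_value (P := glPair G) f c v = 0].
Proof.
have [J [e [ext [extE ext_eq]]]] := exists_basis (quotLie H).
have [lt [lt_irr lt_trans lt_total]] := exists_total_order J.
pose iota := gauge_iota lt_irr lt_trans lt_total e.
pose sgauge x := mksf (gauge_symmetric lt_irr lt_trans lt_total extE ext_eq x).
pose iotal : {linear pmod P -> symfun J (pmod P)} := HB.pack iota
  (GRing.isLinear.Build K (pmod P) (symfun J (pmod P)) *:%R iota
     (gauge_iota_linear lt_irr lt_trans lt_total e)).
exists (symfun J (pmod P)), iotal, (fun x => base_act (sgauge x)).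
exists (top_hom lt_irr lt_trans lt_total extE ext_eq), (base_space H J).
split=> [m m'|m x|x||X v f c].
- by move=> /(congr1 (fun f => sf_val f [::])); rewrite /= /sf_val /= !flow0.
- apply: sf_eq => w; exact: (flow_gauge lt extE ext_eq).
- by apply/asboolP; exists (sgauge x) => // w; apply: (gauge_ker lt extE ext_eq).
- by split; [apply: base_lie | apply: base_top_lie].
- exact: base_identity.
Qed.

(** * Verbal ideals, products of varieties and free cyclic pairs *)

Section VerbalIdeal.
Variables (K : fieldType) (Theta : lieClass K).

Definition lie_law (t : lie_term K) : Prop :=
  forall A : lieAlgType K, Theta A -> forall a : nat -> A, lie_value a t = 0.

Lemma lie_value_hom (A A' : lieAlgType K) (h : lieHom A A') (a : nat -> A) t :
  h (lie_value a t) = lie_value (h \o a) t.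
Proof.
elim: t => //= [t1 e1 t2 e2|c t e|t1 e1 t2 e2].
- by rewrite linearD e1 e2.
- by rewrite linearZ e.
- by rewrite lhom_lie e1 e2.
Qed.

Lemma lie_law_verbal (A : lieAlgType K) (a : nat -> A) t :
  lie_law t -> lie_value a t \in verbal_ideal Theta A.
Proof.
move=> tl; apply/asboolP => J TJ.
have := tl _ TJ (quotLie_proj J \o a); rewrite -lie_value_hom => /= e0.
have : Defs.projv J (lie_value a t) == Defs.projv J 0 by rewrite linear0; apply/eqP.
by rewrite projv_eq subr0.
Qed.

Fixpoint lie_rename (r : nat -> nat) (t : lie_term K) : lie_term K :=
  match t with
  | LieVar i => LieVar K (r i)
  | LieAdd t1 t2 => LieAdd (lie_rename r t1) (lie_rename r t2)
  | LieScale c t1 => LieScale c (lie_rename r t1)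
  | LieBr t1 t2 => LieBr (lie_rename r t1) (lie_rename r t2)
  end.

Lemma lie_value_rename (A : lieAlgType K) (a : nat -> A) r t :
  lie_value a (lie_rename r t) = lie_value (a \o r) t.
Proof. by elim: t => //= [t1 -> t2 ->|c t ->|t1 -> t2 ->]. Qed.

Lemma lie_law_rename r t : lie_law t -> lie_law (lie_rename r t).
Proof. by move=> tl A TA a; rewrite lie_value_rename; apply: tl. Qed.

Section LawValues.
Variable A : lieAlgType K.

(** Single values of laws, rather than sums, so that an element of the verbal ideal can be
    substituted as one Lie term. *)
Definition law_value_pred : {pred A} :=
  fun h => `[< exists t a, lie_law t /\ h = lie_value a t >].

Fact law_value_closed : submod_closed law_value_pred.
Proof.
split.
  apply/asboolP; exists (LieScale 0 (LieVar K 0)), (fun=> 0).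
  by split=> [A' _ a|] /=; rewrite scale0r.
move=> c _ _ /asboolP[t1 [a1 [l1 ->]]] /asboolP[t2 [a2 [l2 ->]]]; apply/asboolP.
(* Even and odd variables keep the two laws apart, so the combination is one law at one family. *)
exists (LieAdd (LieScale c (lie_rename double t1))
               (lie_rename (fun k => k.*2.+1) t2)).
exists (fun k => if odd k then a2 k./2 else a1 k./2); split=> [A' TA a|] /=.
  by rewrite !(lie_law_rename _ _ TA) // scaler0 addr0.
rewrite !lie_value_rename; congr (_ *: lie_value _ t1 + lie_value _ t2).
  by apply/funext => k /=; rewrite odd_double doubleK.
by apply/funext => k /=; rewrite odd_double uphalf_double.
Qed.

Fact law_value_lie (h b : A) : h \in Subspace law_value_closed ->
  lie h b \in Subspace law_value_closed.
Proof.
move=> /asboolP[t [a [tl ->]]]; apply/asboolP.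
exists (LieBr (lie_rename succn t) (LieVar K 0)).
exists (fun k => if k is k'.+1 then a k' else b); split=> [A' TA a'|] /=.
  by rewrite (lie_law_rename _ tl) // lie0l.
by rewrite lie_value_rename.
Qed.

Definition law_values : lieIdeal A :=
  @LieIdeal K A (Subspace law_value_closed) law_value_lie.

(** The values of laws form an ideal whose quotient satisfies the laws of [Theta], as arguments lift
    to [A]; hence it contains the verbal ideal. *)
Lemma verbal_ideal_values : is_lie_variety Theta ->
  forall h, h \in verbal_ideal Theta A ->
  exists t a, lie_law t /\ h = lie_value a t.
Proof.
move=> [E ThetaE] h /asboolP /(_ law_values) vh.
apply/asboolP/vh/ThetaE => t Et a.
have -> : a = quotLie_proj law_values \o (repr \o a).
  by apply/funext => k /=; rewrite projLie_repr.
rewrite -lie_value_hom; apply/eqP.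
rewrite -(linear0 (quotLie_proj _)) projv_eq subr0; apply/asboolP.
by exists t, (repr \o a); split=> // A' /ThetaE/(_ t Et).
Qed.

End LawValues.
End VerbalIdeal.

(** * Identities of the product of varieties *)

Section ProductVariety.
Variables (K : fieldType).

Lemma mon1 (I : choiceType) : mon K [::] = 1 :> freeAssoc K I.
Proof. by rewrite /mon -fmoneE. Qed.

Lemma assocGenE (I : choiceType) (i : I) : assocGen K i = mon K [:: i].
Proof. by rewrite /assocGen fmuE. Qed.

Lemma mulr_mon (I : choiceType) (s t : seq I) :
  mon K s * mon K t = mon K (s ++ t).
Proof.
by rewrite /mon [LHS]malgM_def fgmulUU mulr1 -(fmmulE (FMonom s) (FMonom t)).
Qed.

Lemma act_evalM_gen (I : choiceType) (P : liePair K) (w : pmod P) (a : I -> palg P)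
    (f : freeAssoc K I) i :
  act_eval w a (f * assocGen K i) = pact (act_eval w a f) (a i).
Proof.
have hl : linear (fun f : freeAssoc K I => act_eval w a (f * assocGen K i)).
  by move=> c g g'; rewrite mulrDl -scalerAl linearP.
have hl' : linear (fun f : freeAssoc K I => pact (act_eval w a f) (a i)).
  by move=> c g g'; rewrite linearP /= pact_linearl.
pose h : {linear freeAssoc K I -> pmod P} := HB.pack (fun f : freeAssoc K I =>
  act_eval w a (f * assocGen K i))
  (GRing.isLinear.Build K (freeAssoc K I) (pmod P) *:%R _ hl).
pose h' : {linear freeAssoc K I -> pmod P} := HB.pack (fun f : freeAssoc K I =>
  pact (act_eval w a f) (a i))
  (GRing.isLinear.Build K (freeAssoc K I) (pmod P) *:%R _ hl').
apply: (@linext_inj _ _ _ h h') => -[s].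
rewrite -[<< _ >>]/(mon K s) /= assocGenE mulr_mon !act_eval_mon.
by rewrite /act_word map_cat foldl_cat.
Qed.

Fixpoint lie_poly (t : lie_term K) : freeAssoc K nat :=
  match t with
  | LieVar i => assocGen K i
  | LieAdd t1 t2 => lie_poly t1 + lie_poly t2
  | LieScale c t1 => c *: lie_poly t1
  | LieBr t1 t2 => lie_poly t1 * lie_poly t2 - lie_poly t2 * lie_poly t1
  end.

Lemma act_eval_lie_poly (P : liePair K) (w : pmod P) a f t :
  act_eval w a (f * lie_poly t) = pact (act_eval w a f) (lie_value a t).
Proof.
elim: t f => /= [i|t1 e1 t2 e2|c t e|t1 e1 t2 e2] f.
- exact: act_evalM_gen.
- rewrite (mulrDr f (lie_poly t1)) act_evalD pactDr.
  by congr (_ + _); [apply: e1 | apply: e2].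
- rewrite -scalerAr act_evalZ (linear_morphZ (pact_linearr _)).
  by congr (_ *: _); apply: e.
- rewrite (mulrBr f (lie_poly t1 * lie_poly t2)) act_evalB pact_lie.
  congr (_ - _); apply: (etrans (congr1 (act_eval w a) (mulrA _ _ _))).
    exact: (etrans (e2 _) (congr1 (fun z => pact z _) (e1 _))).
  exact: (etrans (e1 _) (congr1 (fun z => pact z _) (e2 _))).
Qed.

Definition compose_lie (v : freeAssoc K nat) (t : nat -> lie_term K) :
    freeAssoc K nat :=
  linext (fun m : {fmonom nat} =>
    foldl (fun f i => f * lie_poly (t i)) (1 : freeAssoc K nat) (fmonom_val m)) v.

Lemma act_eval_compose (P : liePair K) (w : pmod P) a v t :
  act_eval w a (compose_lie v t) = act_eval w (fun i => lie_value a (t i)) v.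
Proof.
rewrite linext_comp; apply: eq_linext => -[m] _ /=.
have w1 : w = act_eval w a 1 by rewrite -mon1 act_eval_mon.
rewrite [in RHS]w1; elim: m 1 => //= i m IH f.
by rewrite IH act_eval_lie_poly.
Qed.

Variables (X : repClass K) (Theta : lieClass K).

Lemma compose_identity v t : rep_identity X v -> (forall i, lie_law Theta (t i)) ->
  rep_identity (rep_product X Theta) (compose_lie v t).
Proof.
move=> vX tl P XP w a; rewrite -[LHS]/(act_eval w a _) act_eval_compose.
pose c i : subLie (verbal_ideal Theta (palg P)) :=
  exist (fun h => h \in ssp (verbal_ideal Theta (palg P))) _ (lie_law_verbal a (tl i)).
rewrite -[RHS](vX _ XP w c).
exact/esym/(act_eval_hom (restr_incl (verbal_ideal Theta (palg P)))).
Qed.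

(** The product is equational: identities of [X] composed with laws of [Theta] hold in it, and they
    suffice because elements of the verbal ideal are values of laws. *)
Lemma rep_product_of_identities (P : liePair K) :
    is_rep_variety X -> is_lie_variety Theta ->
    (forall v, rep_identity (rep_product X Theta) v -> pair_satisfies P v) ->
  rep_product X Theta P.
Proof.
move=> [E XE] hTheta Pid; apply/XE => v Ev w c.
have vX : rep_identity X v by move=> P' /XE; apply.
have cval i := verbal_ideal_values hTheta (svalP (c i)).
pose t i := projT1 (cid (cval i)).
pose b i := projT1 (cid (projT2 (cid (cval i)))).
have tl i : lie_law Theta (t i) := (projT2 (cid (projT2 (cid (cval i))))).1.
have cE i : sval (c i) = lie_value (b i) (t i) :=
  (projT2 (cid (projT2 (cid (cval i))))).2.
(* Coding pairs by naturals gives the terms [t i] disjoint variables, so one family [a] realizes all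
   families [b i]; numbers coding no pair get 0. *)
pose r (i k : nat) : nat := choice.pickle (i, k).
pose a n : palg P := if choice.unpickle n is Some (i, k) then b i k else 0.
have e0 : @act_eval _ _ P w a (compose_lie v (fun i => lie_rename (r i) (t i))) = 0 :=
  Pid _ (compose_identity vX (fun i => lie_law_rename (r i) (tl i))) w a.
rewrite act_eval_compose in e0.
rewrite -[RHS]e0.
have -> : (fun i => lie_value a (lie_rename (r i) (t i))) = fun i => sval (c i).
  apply/funext => i; rewrite lie_value_rename cE; congr lie_value.
  by apply/funext => k; rewrite /= /a /r choice.pickleK.
exact: (act_eval_hom (restr_incl (verbal_ideal Theta (palg P)))).
Qed.

End ProductVariety.

(** * The free cyclic pair and its universal property *)

Section FreeCyclic.
Variables (K : fieldType) (I : choiceType) (Y : repClass K).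
Variables (L : lieAlgType K) (eta : lieHom L (commLie (freeAssoc K I))).
Let V := verbal_submodule Y (mulPair eta).

Lemma free_cyclic_identity v : rep_identity Y v ->
  pair_satisfies (free_cyclic_pair Y eta) v.
Proof.
move=> vY w a; rewrite -[LHS]/(act_eval w a v) -[w](projv_repr (W := V)).
rewrite -[LHS](act_eval_hom (quot_proj V) (repr w) a v).
apply/eqP; rewrite -(linear0 (hmod (quot_proj V))) projv_eq subr0.
by apply/asboolP => S; apply; exists (repr w), a, v.
Qed.

Variable x : I -> L.
Hypothesis x_gen : forall l, l \in lieGen (range x).
Hypothesis etaE : forall i, eta (x i) = assocGen K i.

(** The elements [l] for which this holds form a Lie subalgebra containing the generators. *)
Lemma act_evalM (R : liePair K) (h : lieHom L (palg R)) (w : pmod R)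
    (f : pmod (mulPair eta)) l :
  act_eval w (h \o x) (pact f l) = pact (act_eval w (h \o x) f) (h l).
Proof.
pose S : {pred L} := fun l => `[< forall f : pmod (mulPair eta),
  act_eval w (h \o x) (pact f l) = pact (act_eval w (h \o x) f) (h l) >].
have S_closed : submod_closed S.
  split.
    apply/asboolP => g; rewrite linear0 !(linear_morph0 (pact_linearr _)).
    exact: act_eval0.
  move=> c l1 l2 /asboolP e1 /asboolP e2; apply/asboolP => g.
  rewrite linearP !pact_linearr act_evalD act_evalZ.
  by congr (_ *: _ + _); [apply: e1 | apply: e2].
have S_lie : {in Subspace S_closed &, forall a b, lie a b \in Subspace S_closed}.
  move=> l1 l2 /asboolP e1 /asboolP e2; apply/asboolP => g.
  rewrite lhom_lie !pact_lie act_evalB; congr (_ - _).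
    exact: (etrans (e2 _) (congr1 (fun z => pact z _) (e1 _))).
  exact: (etrans (e1 _) (congr1 (fun z => pact z _) (e2 _))).
have /asboolP Sl : l \in LieSub S_lie; last exact: Sl.
have /asboolP := x_gen l; apply => _ [i _ <-]; apply/asboolP => g.
by rewrite /pact /= /mulPair_act etaE; apply: act_evalM_gen.
Qed.

(** Identities are asked only on tuples from [h (L)], since [R] will be a full pair of operators or
    the wreath product, which need not lie in [Y]. *)
Lemma free_cyclic_lift (R : liePair K) (h : lieHom L (palg R)) (w : pmod R) :
    (forall v, rep_identity Y v -> forall u (a : nat -> L),
       act_eval u (h \o a) v = 0) ->
  exists2 f : pairHom (free_cyclic_pair Y eta) R, halg f = h &
    forall g, hmod f (Defs.projv V g) = act_eval w (h \o x) g.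
Proof.
move=> Rid; pose E : {linear pmod (mulPair eta) -> pmod R} := act_eval w (h \o x).
pose hE : pairHom (mulPair eta) R := @PairHom K (mulPair eta) R E h (act_evalM h w).
(* The kernel of evaluation is a submodule, so it suffices that it contains the generators of
   [V]. *)
pose kerE : {pred pmod (mulPair eta)} := fun g => E g == 0.
have ker_closed : submod_closed kerE.
  split; first by apply/eqP; apply: act_eval0.
  move=> c g g' /eqP e /eqP e'; apply/eqP.
  by rewrite [LHS]linearP e e' scaler0 addr0.
have ker_act g l : g \in Subspace ker_closed -> pact g l \in Subspace ker_closed.
  move=> /eqP e; apply/eqP; rewrite [E _](hact hE) /= e.
  exact: (linear_morph0 (pact_linearl _)).
have VE g : g \in V -> E g = 0.
  move=> /asboolP /(_ (Submodule ker_act)) Vg; apply/eqP/Vg => _ [u [a [v [vY ->]]]].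
  by apply/eqP; rewrite [LHS](act_eval_hom hE u a v); apply: Rid.
have Er g : E (repr (Defs.projv V g)) = E g.
  apply/eqP; rewrite -subr_eq0 -linearB; apply/eqP/VE.
  by rewrite -projv_eq; apply/eqP; apply: projv_repr.
have fl : linear (fun q : pmod (free_cyclic_pair Y eta) => E (repr q)).
  move=> c q q'; rewrite -[q]projv_repr -[q']projv_repr -linearP.
  by rewrite !Er linearP.
have fact q l : E (repr (@pact K (free_cyclic_pair Y eta) q l)) =
    pact (E (repr q)) (h l).
  exact: (etrans (Er (@pact K (mulPair eta) (repr q) l)) (hact hE (repr q) l)).
exists (@PairHom K (free_cyclic_pair Y eta) R (HB.pack (fun q => E (repr q))
  (GRing.isLinear.Build K (pmod (free_cyclic_pair Y eta)) (pmod R) *:%R _ fl)) h fact).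
  by [].
exact: Er.
Qed.

End FreeCyclic.

(** * Cocones *)

Section Homomorphisms.
Variable K : fieldType.

Section LieComp.
Variables (A B C : lieAlgType K) (g : lieHom B C) (f : lieHom A B).
Fact lieComp_linear : linear (g \o f).
Proof. by move=> c a b; rewrite /= !linearP. Qed.
Fact lieComp_lie a b : (g \o f) (lie a b) = lie ((g \o f) a) ((g \o f) b).
Proof. by rewrite /= !lhom_lie. Qed.
Definition lieComp : lieHom A C :=
  @LieHom K A C (HB.pack (g \o f)
    (GRing.isLinear.Build K A C *:%R (g \o f) lieComp_linear)) lieComp_lie.
End LieComp.

Lemma lieGen_hom (A A' : lieAlgType K) (h : lieHom A A') (S : set A)
    (H : lieSub A') :
  (forall a, S a -> h a \in H) -> forall a, a \in lieGen S -> h a \in H.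
Proof.
move=> SH a.
have pre_closed : submod_closed (fun a : A => `[< h a \in H >]).
  split; first by apply/asboolP; rewrite linear0 rpred0.
  move=> c u v /asboolP uH /asboolP vH; apply/asboolP.
  by rewrite linearP rpredD ?rpredZ.
have pre_lie : {in Subspace pre_closed &,
    forall a b, lie a b \in Subspace pre_closed}.
  move=> u v /asboolP uH /asboolP vH; apply/asboolP.
  by rewrite lhom_lie; apply: lsub_lie.
move=> /asboolP /(_ (LieSub pre_lie)) aH; apply/asboolP/aH => b Sb.
by apply/asboolP/SH.
Qed.

Lemma lieGen_image (A A' : lieAlgType K) (h : lieHom A A') (S : set A') :
  (forall b, S b -> exists a, h a = b) ->
  forall b, b \in lieGen S -> exists a, h a = b.
Proof.
move=> Sh b.
have im_closed : submod_closed (fun b : A' => `[< exists a, h a = b >]).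
  split; first by apply/asboolP; exists 0; rewrite linear0.
  move=> c _ _ /asboolP[u <-] /asboolP[v <-]; apply/asboolP.
  by exists (c *: u + v); rewrite linearP.
have im_lie : {in Subspace im_closed &, forall a b, lie a b \in Subspace im_closed}.
  move=> _ _ /asboolP[u <-] /asboolP[v <-]; apply/asboolP.
  by exists (lie u v); rewrite lhom_lie.
by move=> /asboolP /(_ (LieSub im_lie)) Hb; apply/asboolP/Hb => ? /Sh/asboolP.
Qed.

Section Corestriction.
Variables (A A' : lieAlgType K) (h : lieHom A A') (H : lieSub A').
Hypothesis hH : forall a, h a \in H.
Let f a : subLie H := exist (fun b => b \in ssp H) (h a) (hH a).
Fact corestrLie_linear : linear f.
Proof. by move=> c a b; apply: val_inj; rewrite /= linearP. Qed.
Fact corestrLie_lie a b : f (lie a b) = lie (f a) (f b).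
Proof. by apply: val_inj; rewrite /= lhom_lie. Qed.
Definition corestrLie : lieHom A (subLie H) :=
  @LieHom K A (subLie H) (HB.pack f
    (GRing.isLinear.Build K A (subLie H) *:%R f corestrLie_linear)) corestrLie_lie.
End Corestriction.

(** By uniqueness, mapping [L] to the subalgebra generated by the [x i] and including it back is the
    identity. *)
Lemma free_lie_gen (I : Type) (L : lieAlgType K) (x : I -> L) :
  is_free_lie x -> forall l, l \in lieGen (range x).
Proof.
move=> hL l.
have xG i : x i \in lieGen (range x) by apply/asboolP => H; apply; exists i.
have [h hx _] := hL (subLie (lieGen (range x)))
  (fun i => exist (fun b => b \in ssp (lieGen (range x))) (x i) (xG i)).
have [k _ kU] := hL L x.
have -> : l = sval (h l); last exact: (svalP (h l)).
rewrite -[LHS]/(idHom L l) kU // -(kU (lieComp (subLie_incl _) h)) //= => i.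
by rewrite hx.
Qed.

Lemma free_lie_eq (I : Type) (L A : lieAlgType K) (x : I -> L) (h h' : lieHom L A) :
  is_free_lie x -> (forall i, h (x i) = h' (x i)) -> h =1 h'.
Proof.
move=> hL e l; have [k _ kU] := hL A (fun i => h (x i)).
by rewrite (kU h) // (kU h').
Qed.

Section PairComp.
Variables (P Q R : liePair K) (g : pairHom Q R) (f : pairHom P Q).
Fact pairComp_linear : linear (hmod g \o hmod f).
Proof. by move=> c a b; rewrite /= !linearP. Qed.
Fact pairComp_act w a : (hmod g \o hmod f) (pact w a) =
  pact ((hmod g \o hmod f) w) (lieComp (halg g) (halg f) a).
Proof. by rewrite /= !hact. Qed.
Definition pairComp : pairHom P R :=
  @PairHom K P R (HB.pack (hmod g \o hmod f)
    (GRing.isLinear.Build K (pmod P) (pmod R) *:%R (hmod g \o hmod f)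
       pairComp_linear)) (lieComp (halg g) (halg f)) pairComp_act.
End PairComp.

(** Intertwining is required on letters only, so no Lie homomorphism has to accompany [h]. *)
Lemma act_eval_map (I : choiceType) (P Q : liePair K) (h : {linear pmod P -> pmod Q})
    (a : I -> palg P) (b : I -> palg Q) w g :
  (forall m i, h (pact m (a i)) = pact (h m) (b i)) ->
  h (act_eval w a g) = act_eval (h w) b g.
Proof.
move=> hE; rewrite /act_eval linext_comp; apply: eq_linext => m _ /=.
by elim: (fmonom_val m) w => //= i s IH w; rewrite /act_word /= IH hE.
Qed.

Lemma act_eval_mulPair (I : choiceType) (L : lieAlgType K)
    (eta : lieHom L (commLie (freeAssoc K I))) (x : I -> L) (g : freeAssoc K I) :
  (forall i, eta (x i) = assocGen K i) ->
  @act_eval K I (mulPair eta) (1 : freeAssoc K I) x g = g.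
Proof.
move=> etaE; rewrite -[RHS]linextK; apply: eq_linext => -[m] _ /=.
rewrite -[RHS]/(mon K m) -mon1 -[in RHS](cat0s m).
elim: m [::] => [|i m IH] s; first by rewrite cats0.
rewrite /act_word /= -/(act_word _ _ _) -cat_rcons -IH; congr (foldl _ _ _).
by rewrite /mulPair_act etaE assocGenE mulr_mon cats1.
Qed.

Section PullPair.
Variables (Q : liePair K) (L : lieAlgType K) (h : lieHom L (palg Q)).
Let act (w : pmod Q) (l : L) : pmod Q := pact w (h l).
Fact pullPair_linearl l : linear (fun w => act w l).
Proof. exact: pact_linearl. Qed.
Fact pullPair_linearr w : linear (act w).
Proof. by move=> c u v; rewrite /act linearP pact_linearr. Qed.
Fact pullPair_lie w u v : act w (lie u v) = act (act w u) v - act (act w v) u.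
Proof. by rewrite /act lhom_lie pact_lie. Qed.
Definition pullPair : liePair K :=
  LiePair pullPair_linearl pullPair_linearr pullPair_lie.
End PullPair.

End Homomorphisms.

(** * A cocone cut out of a larger pair *)

Section Cocone.
Variables (K : fieldType) (X : repClass K) (hX : is_rep_variety X).
Variables (P R : liePair K) (B : lieAlgType K).
Variables (phi : pairHom P R) (psi : lieHom B (palg R)) (C : subspace (palg R)).
Hypothesis phiC : forall a, halg phi a \in C.
Hypothesis C_lie : {in C &, forall c d, lie c d \in C}.
Hypothesis C_psi : forall c b, c \in C -> lie c (psi b) \in C.
Hypothesis C_id : forall v w (c : nat -> palg R), rep_identity X v ->
  (forall i, c i \in C) -> act_value w c v = 0.

Let S : set (palg R) := (range (halg phi) `|` range psi)%classic.
Let N := lieGen S.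
Let R2 := restrPair N.
Let W := submodGen (P := R2) (range (hmod phi)).
(** Passing to the generated subalgebra and submodule secures the two generation conditions; [C]
    will control the ideal. *)
Let Q : liePair K := submodPair W.

Let phiN a : halg phi a \in N.
Proof. by apply/asboolP => H; apply; left; exists a. Qed.
Let psiN b : psi b \in N.
Proof. by apply/asboolP => H; apply; right; exists b. Qed.
Let phiW w : hmod phi w \in W.
Proof. by apply/asboolP => H; apply; exists w. Qed.

Let phi1_mod w : pmod Q := exist (fun u => u \in ssp W) (hmod phi w) (phiW w).
Let phi1_alg : lieHom (palg P) (palg Q) := corestrLie phiN.

Fact phi1_mod_linear : linear phi1_mod.
Proof. by move=> c u v; apply: val_inj; rewrite /= linearP. Qed.

Fact phi1_act w a : phi1_mod (pact w a) = pact (phi1_mod w) (phi1_alg a).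
Proof. by apply: val_inj; rewrite /= hact. Qed.

Definition cocone_phi : pairHom P Q :=
  @PairHom K P Q (HB.pack phi1_mod
    (GRing.isLinear.Build K (pmod P) (pmod Q) *:%R phi1_mod phi1_mod_linear))
    phi1_alg phi1_act.
Definition cocone_psi : lieHom B (palg Q) := corestrLie psiN.
Definition cocone_incl : pairHom Q R := pairComp (restr_incl N) (submod_incl W).

(** The normalizer of [C] is a subalgebra by the Jacobi identity, and it contains both generating
    images. *)
Lemma normalizes c n : n \in N -> c \in C -> lie c n \in C.
Proof.
have nrm_closed : submod_closed (fun n : palg R =>
    `[< forall c, c \in C -> lie c n \in C >]).
  split; first by apply/asboolP => d _; rewrite lie0r rpred0.
  move=> k u v /asboolP uC /asboolP vC; apply/asboolP => d dC.
  by rewrite lie_linearr rpredD ?rpredZ ?uC ?vC.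
have nrm_lie : {in Subspace nrm_closed &,
    forall a b, lie a b \in Subspace nrm_closed}.
  move=> u v /asboolP uC /asboolP vC; apply/asboolP => d dC.
  by rewrite adPair_lie rpredB ?uC ?vC ?uC ?vC.
move=> /asboolP/(_ (LieSub nrm_lie)) nN; move: c; apply/asboolP/nN.
by move=> _ [[a _ <-]|[b _ <-]]; apply/asboolP => d dC; [apply: C_lie|apply: C_psi].
Qed.

Lemma cocone_incl_act (v : freeAssoc K nat) w (c : nat -> palg Q) :
  rep_identity X v -> (forall i, sval (c i) \in C) -> act_value w c v = 0.
Proof.
move=> vX cC; apply: val_inj => /=.
rewrite -[LHS]/(hmod cocone_incl (act_eval w c v)) act_eval_hom.
exact: C_id.
Qed.

Lemma cocone_is_cocone : wreath_cocone X cocone_phi cocone_psi.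
Proof.
split.
- move=> g; apply/asboolP => H HS.
  (* Generation has to hold inside [N]: the elements of [palg R] coming from [H] form a subalgebra
     containing [S], hence [N]. *)
  have im_closed : submod_closed (fun a : palg R =>
      `[< exists2 b : subLie N, b \in H & sval b = a >]).
    split; first by apply/asboolP; exists 0; rewrite ?rpred0.
    move=> c _ _ /asboolP[u uH <-] /asboolP[v vH <-]; apply/asboolP.
    by exists (c *: u + v); rewrite // rpredD ?rpredZ.
  have im_lie : {in Subspace im_closed &,
      forall a b, lie a b \in Subspace im_closed}.
    move=> _ _ /asboolP[u uH <-] /asboolP[v vH <-]; apply/asboolP.
    by exists (lie u v) => //; apply: lsub_lie.
  have /asboolP/(_ (LieSub im_lie)) := svalP g; case/(_ _)/asboolP => [|b bH /val_inj<-//].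
  move=> _ [[a _ <-]|[b _ <-]]; apply/asboolP.
    by exists (phi1_alg a) => //; apply: HS; left; exists a.
  by exists (cocone_psi b) => //; apply: HS; right; exists b.
- move=> w; apply/asboolP => T TS.
  have im_closed : submod_closed (fun a : pmod R2 =>
      `[< exists2 b : pmod Q, b \in T & sval b = a >]).
    split; first by apply/asboolP; exists 0; rewrite ?rpred0.
    move=> c _ _ /asboolP[u uH <-] /asboolP[v vH <-]; apply/asboolP.
    by exists (c *: u + v); rewrite // rpredD ?rpredZ.
  have im_act u (n : palg R2) : u \in Subspace im_closed ->
      pact u n \in Subspace im_closed.
    move=> /asboolP[v vT <-]; apply/asboolP.
    by exists (@pact K Q v n) => //; apply: smod_act.
  have /asboolP/(_ (Submodule im_act)) := svalP w.
  case/(_ _)/asboolP => [|b bH /val_inj<-//].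
  move=> _ [u _ <-]; apply/asboolP.
  by exists (phi1_mod u) => //; apply: TS; exists u.
- case: hX => E XE; apply/XE => v Ev w c.
  have vX : rep_identity X v by move=> P' /XE; apply.
  set I := idealGen _ in c w *.
  (* The preimage of [C] is an ideal of [N], so it contains the ideal generated by the image of
     [phi]. *)
  have JC_closed : submod_closed (fun g : palg Q => `[< sval g \in C >]).
    split; first by apply/asboolP; rewrite rpred0.
    move=> k u u' /asboolP uC /asboolP u'C; apply/asboolP.
    by rewrite rpredD ?rpredZ.
  have JC_lie (a b : palg Q) : a \in Subspace JC_closed ->
      lie a b \in Subspace JC_closed.
    by move=> /asboolP aC; apply/asboolP/normalizes => //; exact: (svalP b).
  have IC (i : subLie I) : sval (sval i) \in C.
    have /asboolP/(_ (LieIdeal JC_lie)) iC := svalP i; apply/asboolP/iC.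
    by move=> _ [a _ <-]; apply/asboolP/phiC.
  rewrite -[LHS]/(hmod (restr_incl I) (@act_eval _ _ (restrPair I) w c v)).
  rewrite act_eval_hom.
  by apply: cocone_incl_act => // i; apply: IC.
Qed.

End Cocone.

(** * The theorem *)

Lemma bijective_of_inj_surj (U V : Type) (f : U -> V) :
  injective f -> (forall v, exists u, f u = v) -> bijective f.
Proof.
move=> finj fsurj; exists (fun v => projT1 (cid (fsurj v))).
  by move=> u; apply: finj; apply: (projT2 (cid (fsurj (f u)))).
by move=> v; apply: (projT2 (cid (fsurj v))).
Qed.

Section MainProof.
Variables (K : fieldType) (X : repClass K).
Hypotheses (hX : is_rep_variety X) (hXmh : multihomogeneous X).
Variables (Theta : lieClass K) (hTheta : is_lie_variety Theta).
Variables (I : choiceType) (L : lieAlgType K) (x : I -> L).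
Hypothesis hL : is_free_lie x.
Variable eta : lieHom L (commLie (freeAssoc K I)).
Hypothesis heta : forall i, eta (x i) = assocGen K i.
Variables (L1 : lieAlgType K) (y : I -> L1).
Hypothesis hL1 : is_free_lie y.
Variable eta1 : lieHom L1 (commLie (freeAssoc K I)).
Hypothesis heta1 : forall i, eta1 (y i) = assocGen K i.
Variables (Q : liePair K) (phi : pairHom (free_cyclic_pair X eta1) Q)
  (psi : lieHom (quotLie (verbal_ideal Theta L)) (palg Q)).
Hypothesis hQ : is_mixed_wreath X phi psi.

Let p : lieHom L (quotLie (verbal_ideal Theta L)) := quotLie_proj _.
Let Y := rep_product X Theta.
Let M := free_cyclic_pair Y eta.
Let g0 := hmod phi (free_cyclic_gen X eta1).

Variable h : lieHom L (palg Q).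
Hypothesis hx : forall i, h (x i) = halg phi (y i) + psi (p (x i)).

(** Two Lie homomorphisms agree modulo an ideal on a subalgebra, and here it contains the
    generators. *)
Lemma wreath_embed_mod_base l : h l - psi (p l) \in idealGen (range (halg phi)).
Proof.
set J := idealGen _.
have S_closed : submod_closed (fun l => `[< h l - psi (p l) \in J >]).
  split; first by apply/asboolP; rewrite !linear0 addr0 rpred0.
  move=> c u v /asboolP uJ /asboolP vJ; apply/asboolP.
  by rewrite (linearP h) (linearP p) (linearP psi) opprD addrACA -scalerBr rpredD ?rpredZ.
have S_lie : {in Subspace S_closed &, forall a b, lie a b \in Subspace S_closed}.
  move=> u v /asboolP uJ /asboolP vJ; apply/asboolP.
  rewrite !lhom_lie -[lie (h u) _](subrK (lie (psi (p u)) (h v))) -addrA.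
  rewrite -lieBl -lieBr rpredD //; first exact: (lideal_lie (l := J)).
  by rewrite lieC rpredN; apply: (lideal_lie (l := J)).
have /asboolP Sl : l \in LieSub S_lie; last exact: Sl.
have /asboolP := free_lie_gen hL l; apply => _ [i _ <-]; apply/asboolP.
by rewrite hx addrK; apply/asboolP => J'; apply; exists (y i).
Qed.

Lemma wreath_embed_inj : injective h.
Proof.
have zl : linear (fun _ : 'rV[K]_0 => 0 : 'rV[K]_0).
  by move=> c u v; rewrite scaler0 addr0.
have zr (w : 'rV[K]_0) : linear (fun _ : L => 0 : 'rV[K]_0).
  by move=> c u v; rewrite scaler0 addr0.
have zlie (w : 'rV[K]_0) (a b : L) : (0 : 'rV[K]_0) = 0 - 0 by rewrite subrr.
(* With the zero module, the cocone conditions reduce to generation of the Lie algebra. *)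
pose Z := @LiePair K 'rV[K]_0 L (fun _ _ => 0) (fun=> zl) zr zlie.
have Z0 (w : pmod Z) : w = 0 by apply/rowP => -[].
have [k kE _] := @hL1 _ x.
have ml : linear (fun _ : pmod (free_cyclic_pair X eta1) => 0 : pmod Z).
  by move=> c u v; rewrite scaler0 addr0.
pose phi1 : pairHom (free_cyclic_pair X eta1) Z :=
  @PairHom K (free_cyclic_pair X eta1) Z (HB.pack (fun _ : pmod (free_cyclic_pair X eta1) => 0 : pmod Z)
    (GRing.isLinear.Build K (pmod (free_cyclic_pair X eta1)) (pmod Z) *:%R _ ml)) k (fun _ _ => erefl).
have pl : linear (fun _ : quotLie (verbal_ideal Theta L) => 0 : L).
  by move=> c u v; rewrite scaler0 addr0.
have plie (a b : quotLie (verbal_ideal Theta L)) : 0 = lie 0 0 :> L by rewrite lie0l.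
pose psi1 : lieHom (quotLie (verbal_ideal Theta L)) (palg Z) :=
  @LieHom K (quotLie (verbal_ideal Theta L)) L (HB.pack
    (fun _ : quotLie (verbal_ideal Theta L) => 0 : L)
    (GRing.isLinear.Build K (quotLie (verbal_ideal Theta L)) L *:%R _ pl)) plie.
have cc : wreath_cocone X phi1 psi1.
  split=> [g|w|].
  - apply/asboolP => H HS; have /asboolP := free_lie_gen hL g; apply.
    by move=> _ [i _ <-]; apply: HS; left; exists (y i) => //=; rewrite kE.
  - by apply/asboolP => S _; rewrite (Z0 w) rpred0.
  - by case: hX => E XE; apply/XE => v _ w c; apply: Z0.
have [chi [_ chiA chiB] _] := wreath_univ hQ cc.
apply: (can_inj (g := halg chi)) => l.
have := @free_lie_eq _ _ _ _ _ (lieComp (halg chi) h) (idHom L) hL; apply=> i /=.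
by rewrite hx linearD /= chiA chiB /= kE addr0.
Qed.

(** The pullback of [Q] along [h] lies in the product variety: [p] kills the verbal ideal, so [h]
    sends it into the ideal that acts as prescribed by [X]. *)
Lemma wreath_pull_identity v : rep_identity Y v ->
  forall u (a : nat -> L), act_eval u (h \o a) v = 0.
Proof.
move=> vY u a.
pose incl := @PairHom K (pullPair h) Q idfun h (fun _ _ => erefl).
have YP : Y (pullPair h).
  have XJ := cocone_ideal (wreath_is_cocone hQ).
  case: hX => E XE; apply/XE => t Et w c.
  have tX : rep_identity X t by move=> P /XE; apply.
  set J := idealGen _ in XJ.
  have cJ i : h (sval (c i)) \in J.
    have := wreath_embed_mod_base (sval (c i)).
    rewrite (_ : p _ = 0) ?linear0 ?addr0 //.
    apply/eqP; rewrite -(linear0 p) projv_eq subr0; exact: (svalP (c i)).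
  pose d i : subLie J := exist (fun b => b \in ssp J) _ (cJ i).
  rewrite -[RHS](tX _ XJ w d).
  rewrite -[LHS]/(hmod incl (hmod (restr_incl _) (act_eval w c t))).
  rewrite -[RHS]/(hmod (restr_incl J) (@act_eval _ _ (restrPair J) w d t)).
  by rewrite !act_eval_hom; apply: (act_eval_hom incl _ _ t).
by rewrite -[RHS](vY _ YP u a) -[RHS]/(hmod incl (@act_eval _ _ (pullPair h) u a v)) act_eval_hom.
Qed.

(** This ensures that the verbal ideal of [L] acts on [M] as prescribed by [X], which the gauge
    embedding requires. *)
Lemma free_cyclic_mem : Y M.
Proof.
apply: rep_product_of_identities => // v vY; exact: free_cyclic_identity.
Qed.

(** A relation on [g0] in the wreath product is transported to the operators on [G], where it
    becomes the image under [iota] of the class of [g]. *)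
Lemma wreath_embed_ker (g : freeAssoc K I) : act_eval g0 (h \o x) g = 0 ->
  Defs.projv (verbal_submodule Y (mulPair eta)) g = 0.
Proof.
set V := verbal_submodule _ _ => e0.
have [G [iota [omega [psi0 [C [iota_inj iotaE omegaC [C_lie C_psi] C_id]]]]]] :=
  @gauge_embedding K M (verbal_ideal Theta L).
(* The generator [y i] acts as the base part of [x i]; it then stays in [C], which is a Lie
   subalgebra. *)
have [k kE _] := @hL1 _ (fun i => omega (x i)).
have kC a : k a \in C.
  apply: (@lieGen_hom _ _ _ k (range y) (LieSub C_lie)); last exact: free_lie_gen.
  by move=> _ [i _ <-]; rewrite kE; apply: omegaC.
have Cid v w (c : nat -> palg (glPair G)) : rep_identity X v ->
    (forall i, c i \in C) -> act_value (P := glPair G) w c v = 0.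
  move=> vX cC; apply: C_id vX cC => //; exact: free_cyclic_mem.
have [phi0 phi0k phi0E] := @free_cyclic_lift K I X L1 eta1 y (free_lie_gen hL1) heta1
  (glPair G) k (iota (Defs.projv V 1))
  (fun v vX u a => Cid v u _ vX (fun i => kC (a i))).
have phi0C a : halg phi0 a \in C by rewrite phi0k.
have cc := @cocone_is_cocone K X hX _ (glPair G) _ phi0 psi0 C phi0C C_lie C_psi Cid.
have [chi [chiV chiA chiB] _] := wreath_univ hQ cc.
(* The map [t] sends [g0] to the image of 1, and [h (x i)] to an operator that restricts to [x i] on
   [iota (M)]. *)
pose t := pairComp (cocone_incl phi0 psi0) chi.
have tV w : hmod t (hmod phi w) = hmod phi0 w by rewrite /= chiV.
have tA a : halg t (halg phi a) = halg phi0 a by rewrite /= chiA.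
have tB b : halg t (psi b) = psi0 b by rewrite /= chiB.
have tg0 : hmod t g0 = iota (Defs.projv V 1).
  by rewrite tV phi0E -mon1 act_eval_mon.
apply: iota_inj; rewrite linear0.
have -> : Defs.projv V g = act_eval (P := M) (Defs.projv V 1) x g.
  rewrite -[in LHS](@act_eval_mulPair _ _ _ eta x g heta).
  exact: (act_eval_hom (quot_proj V) (1 : freeAssoc K I) x g).
have nablaE m i : iota (@pact K M m (x i)) =
    @pact K (glPair G) (iota m) (halg t (h (x i))).
  by rewrite iotaE hx linearD /= chiA chiB /=  phi0k kE.
rewrite (@act_eval_map _ _ M (glPair G) iota x (halg t \o (h \o x))) //.
by rewrite -tg0 -act_eval_hom e0 linear0.
Qed.

End MainProof.

Theorem corollary1 (K : fieldType)
  (X : repClass K) (hX : is_rep_variety X) (hXmh : multihomogeneous X)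
  (Theta : lieClass K) (hTheta : is_lie_variety Theta)
  (I : choiceType)
  (L : lieAlgType K) (x : I -> L) (hL : is_free_lie x)
  (eta : lieHom L (commLie (freeAssoc K I)))
  (heta : forall i, eta (x i) = assocGen K i)
  (L1 : lieAlgType K) (y : I -> L1) (hL1 : is_free_lie y)
  (eta1 : lieHom L1 (commLie (freeAssoc K I)))
  (heta1 : forall i, eta1 (y i) = assocGen K i)
  (Q : liePair K)
  (phi : pairHom (free_cyclic_pair X eta1) Q)
  (psi : lieHom (quotLie (verbal_ideal Theta L)) (palg Q))
  (hQ : is_mixed_wreath X phi psi) :
  pair_isom (free_cyclic_pair (rep_product X Theta) eta)
    (cyclicSubpair (hmod phi (free_cyclic_gen X eta1))
       (range (fun i : I =>
          halg phi (y i) + psi (projLie (verbal_ideal Theta L) (x i))))).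
Proof.
pose p : lieHom L (quotLie (verbal_ideal Theta L)) := quotLie_proj _.
have [h hx _] := hL (palg Q) (fun i => halg phi (y i) + psi (p (x i))).
pose g0 := hmod phi (free_cyclic_gen X eta1).
pose S := range (fun i => halg phi (y i) + psi (projLie (verbal_ideal Theta L) (x i))).
pose N := lieGen S; pose W := submodGen (P := restrPair N) [set g0]%classic.
have hN l : h l \in N.
  apply: (lieGen_hom (S := range x)); last exact: free_lie_gen.
  by move=> _ [i _ <-]; rewrite hx; apply/asboolP => H; apply; exists i.
have [f fh fE] := @free_cyclic_lift K I (rep_product X Theta) L eta x
  (free_lie_gen hL) heta Q h g0 (wreath_pull_identity hX hL hQ hx).
have fact w l : hmod f (pact w l) = pact (hmod f w) (h l) by rewrite hact fh.
have g0W : g0 \in W by apply/asboolP => T; apply.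
(* [W] is stable under [N] only; words in the [h (x i)] preserve it because [h] takes values in
   [N]. *)
have wordW s (u : pmod Q) : u \in W -> act_word u (h \o x) s \in W.
  elim: s u => // i s IH u uW; apply: (IH (pact u (h (x i)))).
  pose n : subLie N := exist (fun b => b \in ssp N) (h (x i)) (hN (x i)).
  exact: (@smod_act K (restrPair N) W u n uW).
have fW m : hmod f m \in W.
  rewrite -(projv_repr m) fE; apply: rpred_sum => -[s] _; apply: rpredZ.
  exact: wordW.
pose F m : pmod (submodPair W) := exist (fun u => u \in ssp W) (hmod f m) (fW m).
have F_linear : linear F by move=> c u v; apply: val_inj; rewrite /= linearP.
have F_act w l : F (pact w l) = pact (F w) (corestrLie hN l).
  by apply: val_inj; rewrite /= fact.
exists (@PairHom K (free_cyclic_pair (rep_product X Theta) eta) (submodPair W)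
  (HB.pack F (GRing.isLinear.Build K (pmod (free_cyclic_pair (rep_product X Theta) eta))
     (pmod (submodPair W)) *:%R F F_linear)) (corestrLie hN) F_act).
have f_ker m : hmod f m = 0 -> m = 0.
  rewrite -(projv_repr m) fE.
  exact: (wreath_embed_ker hX hXmh hTheta heta hL1 heta1 hQ hx).
have f_inj : injective (hmod f).
  move=> m m' e; apply/eqP; rewrite -subr_eq0; apply/eqP/f_ker.
  by rewrite linearB e subrr.
have hsurj b : b \in N -> exists l, h l = b.
  by apply: lieGen_image => _ [i _ <-]; exists (x i); rewrite hx.
split; apply: bijective_of_inj_surj => /=.
- by move=> m m' /(congr1 sval) /f_inj.
- move=> w; suff [m fm] : exists m, hmod f m = sval w by exists m; apply: val_inj.
  (* The image of [f] contains [g0], and it is stable under [N] because [h] maps onto [N]. *)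
  have im_closed : submod_closed (fun u : pmod (restrPair N) =>
      `[< exists m, hmod f m = u >]).
    split; first by apply/asboolP; exists 0; rewrite linear0.
    move=> c _ _ /asboolP[m <-] /asboolP[m' <-]; apply/asboolP.
    by exists (c *: m + m'); rewrite linearP.
  have im_act u (n : palg (restrPair N)) : u \in Subspace im_closed ->
      pact u n \in Subspace im_closed.
    move=> /asboolP[m <-]; have [l hl] := hsurj _ (svalP n); apply/asboolP.
    by exists (pact m l); rewrite fact hl.
  have /asboolP/(_ (Submodule im_act)) wW := svalP w; apply/asboolP/wW.
  move=> _ ->; apply/asboolP.
  exists (Defs.projv _ (1 : freeAssoc K I)).
  by rewrite fE -mon1 act_eval_mon.
- by move=> l l' /(congr1 sval) /=; apply: (wreath_embed_inj hX hL hL1 hQ hx).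
- move=> b; have [l hl] := hsurj _ (svalP b); exists l; exact: val_inj.
Qed.
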